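(* Let $n\ge 1$ and let $\lambda=\{\lambda_0<\lambda_1<\dots<\lambda_n\}$ be a set of distinct real numbers. The orbit space $Q_n=M_{\mathrm{St}_n,\lambda}/T^n\simeq\mathcal{R}_n$ is homotopy equivalent to the cell complex $\mathrm{Sq}_{n-1}$ of cubical faces of the $(n-1)$-dimensional permutohedron.
   Context: Rows and columns are indexed by $0,1,\dots,n$. A Hermitian arrow matrix is a Hermitian $(n+1)\times(n+1)$-matrix $A=(a_{ij})$ whose entries vanish outside the main diagonal, the row $0$ and the column $0$. $M_{\mathrm{St}_n,\lambda}$ is the space of Hermitian arrow matrices with spectrum $\lambda$. The torus $T^{n+1}$ of diagonal unitary matrices acts on it by conjugation, scalar matrices act trivially, and this gives the action of $T^n=T^{n+1}/\Delta(T^1)$ on $M_{\mathrm{St}_n,\lambda}$. $\mathcal{R}_n=\bigcup_{\sigma\in\Sigma_n}I_{\sigma(1)}\times\cdots\times I_{\sigma(n)}\subset\mathbb{R}^n$, where $I_j=[\lambda_{j-1},\lambda_j]$ and $\Sigma_n$ is the symmetric group. The symbol $\simeq$ denotes homotopy equivalence: the map $Q_n\to\mathcal{R}_n$ induced by $A\mapsto(a_{11},\dots,a_{nn})$ is a homotopy equivalence. The faces of the permutohedron $\mathrm{Pe}^{n-1}$ correspond to linearly ordered partitions $S=(S_1,\dots,S_k)$ of $[n]=\{1,\dots,n\}$ into nonempty subsets, ordered by order-preserving refinement ($F_S\subseteq F_{S'}$ iff $S$ is an order-preserving refinement of $S'$). The face $F_S$ is combinatorially isomorphic to $\mathrm{Pe}^{|S_1|-1}\times\cdots\times\mathrm{Pe}^{|S_k|-1}$;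 it is called cubical if $|S_i|\le 2$ for all $i$. $\mathrm{Sq}_{n-1}$ is the subcomplex of $\mathrm{Pe}^{n-1}$ formed by all cubical faces. *)

(* Defs.v *)
From HB Require Import structures.
From mathcomp Require Import all_boot all_order all_fingroup all_algebra.
From mathcomp Require Import generic_quotient spectral complex.
From mathcomp Require Import all_classical all_reals.
From mathcomp Require Import topology normedtype convex.

Set Implicit Arguments.
Unset Strict Implicit.
Unset Printing Implicit Defensive.

Import Order.TTheory GRing.Theory Num.Theory.
Import numFieldNormedType.Exports.

Local Open Scope classical_set_scope.
Local Open Scope ring_scope.
Local Open Scope complex_scope.
Local Open Scope sesquilinear_scope.
Local Open Scope quotient_scope.

(* [R[i]] carries the topology of its norm [`|a +i* b| = sqrt (a^2 + b^2)]. *)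
HB.instance Definition _ (R : realType) :=
  PseudoPointedMetric.copy R[i] (R[i])^o.

Section Homotopy.
Context (R : realType).

Definition homotopic (X Y : topologicalType) (f g : X -> Y) : Prop :=
  exists H : X * R -> Y,
    [/\ {within [set: X] `*` `[0, 1]%classic, continuous H},
        forall x, H (x, 0) = f x & forall x, H (x, 1) = g x].

Definition is_homotopy_equivalence (X Y : topologicalType) (f : X -> Y) : Prop :=
  continuous f /\
  exists g : Y -> X,
    [/\ continuous g, homotopic (g \o f) id & homotopic (f \o g) id].

Definition homotopy_equivalent (X Y : topologicalType) : Prop :=
  exists f : X -> Y, is_homotopy_equivalence f.

End Homotopy.

Section ArrowMatrices.
Context (R : realType) (n : nat).
Local Notation C := R[i].

Definition is_arrow (A : 'M[C]_n.+1) : Prop :=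
  forall i j, i != j -> i != ord0 -> j != ord0 -> A i j = 0.

(* The eigenvalues [lam] are meant to be pairwise distinct, so the spectrum of a
   matrix of size [n.+1] can be given as a set. *)
Definition arrow_space (lam : 'I_n.+1 -> R) : set 'M[C]_n.+1 :=
  [set A | [/\ A \is hermsymmx, is_arrow A &
              [set z | eigenvalue A z] = [set (lam i)%:C | i in [set: 'I_n.+1]]]].

Definition torus : set 'M[C]_n.+1 :=
  [set D | is_diag_mx D /\ D \is unitarymx].

Definition torus_act (D A : 'M[C]_n.+1) : 'M[C]_n.+1 := D *m A *m D ^t*.

(* Scalar matrices act trivially, so the orbits of [T^n = T^(n+1) / Delta (T^1)]
   are those of [T^(n+1)]. *)
Definition same_orbit (A B : 'M[C]_n.+1) : Prop :=
  exists2 D, torus D & B = torus_act D A.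

Lemma same_orbit_refl A : same_orbit A A.
Proof.
exists 1%:M; last by rewrite /torus_act trmx1 map_mx1 mul1mx mulmx1.
split; first exact: scalar_mx_is_diag.
by apply/unitarymxP; rewrite trmx1 map_mx1 mulmx1.
Qed.

Lemma same_orbit_sym A B : same_orbit A B -> same_orbit B A.
Proof.
move=> [D [Dd /unitarymxP Du] ->].
have Du' : D ^t* *m D = 1%:M by apply: mulmx1C.
exists (D ^t*).
  split; last by apply/unitarymxP; rewrite trmxCK.
  by apply/is_diag_mxP => i j ij; rewrite !mxE (is_diag_mxP Dd) ?conjC0 1?eq_sym.
by rewrite /torus_act trmxCK !mulmxA Du' mul1mx -mulmxA Du' mulmx1.
Qed.

Lemma same_orbit_trans A B E :
  same_orbit A B -> same_orbit B E -> same_orbit A E.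
Proof.
move=> [D [Dd /unitarymxP Du] ->] [F [Fd /unitarymxP Fu] ->].
have FDE : (F *m D) ^t* = D ^t* *m F ^t* by rewrite trmx_mul map_mxM.
exists (F *m D); last by rewrite /torus_act FDE !mulmxA.
split; last first.
  by apply/unitarymxP; rewrite FDE !mulmxA -(mulmxA F) Du mulmx1 Fu.
have [/diag_mxP[d ->] /diag_mxP[f ->]] := (Dd, Fd).
by rewrite mulmx_diag; apply: diag_mx_is_diag.
Qed.

Context (lam : 'I_n.+1 -> R).

Definition orbit_rel : rel (arrow_space lam) :=
  fun A B => `[< same_orbit (\val A) (\val B) >].

Lemma orbit_rel_equiv : equiv_class_of orbit_rel.
Proof.
split.
- by move=> A; apply/asboolP; exact: same_orbit_refl.
- by move=> A B; apply/asboolP/asboolP; exact: same_orbit_sym.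
- move=> B A E /asboolP AB /asboolP BE; apply/asboolP.
  exact: same_orbit_trans AB BE.
Qed.

Canonical orbit_equiv := EquivRelPack orbit_rel_equiv.

Definition orbit_space : topologicalType :=
  quotient_topology {eq_quot orbit_equiv}.

Definition orbit_of (A : arrow_space lam) : orbit_space :=
  \pi_({eq_quot orbit_equiv})%qT A.

(* [j : 'I_n] stands for the index [j.+1] of [[n]], so the interval
   [I_(j.+1) = [lam_j, lam_(j.+1)]] is the one below. *)
Definition lam_interval (j : 'I_n) : set R :=
  `[lam (widen_ord (leqnSn n) j), lam (lift ord0 j)]%classic.

Definition interval_boxes : set 'rV[R]_n :=
  [set x : 'rV[R]_n | exists s : 'S_n, forall i, lam_interval (s i) (x ord0 i)].

End ArrowMatrices.

Section Permutohedron.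
Context (R : realType) (n : nat).
Implicit Types S : seq {set 'I_n}.

Definition ordered_partition S : bool :=
  uniq S && finset.partition [set:: S]%SET [set: 'I_n]%SET.

(* [S'] is obtained from [S] by merging runs of consecutive blocks. *)
Definition refines S S' : Prop :=
  exists2 ss : seq (seq {set 'I_n}),
    S = flatten ss & S' = [seq (\bigcup_(B <- s) B)%SET | s <- ss].

Definition vertex_partition (s : 'S_n) : seq {set 'I_n} :=
  [seq [set i | s i == k]%SET | k <- enum 'I_n].

Definition vertex (s : 'S_n) : 'rV[R]_n := \row_i (s i).+1%:R.

Definition convex_hull (V : set 'rV[R]_n) : set 'rV[R]_n :=
  smallest (@convex_set R 'rV[R]_n) V.

(* The permutohedron is realized as the convex hull of the vectors [vertex s];
   it is the face of the one-block partition. *)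
Definition face S : set 'rV[R]_n :=
  convex_hull [set vertex s | s in [set s | refines (vertex_partition s) S]].

Definition cubical S : bool := all (fun B : {set 'I_n} => (#|B| <= 2)%N) S.

Definition cubical_complex : set 'rV[R]_n :=
  [set x | exists S, [/\ ordered_partition S, cubical S & face S x]].

End Permutohedron.

Arguments cubical_complex : clear implicits.

(* Main.v *)
Require Import Defs.
From HB Require Import structures.
From mathcomp Require Import all_boot all_order all_fingroup all_algebra.
From mathcomp Require Import generic_quotient spectral complex.
From mathcomp Require Import all_classical all_reals.
From mathcomp Require Import topology normedtype convex.
From mathcomp Require realfun.
From mathcomp Require Import ring lra zify.

Import Order.TTheory GRing.Theory Num.Theory.
Import numFieldNormedType.Exports.

(** Write an arrow matrix A with spectrum lam as a diagonal a_0, a_1, ..., a_n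
    and a row b_1, ..., b_n.  The torus multiplies the b_i by independent
    phases, so an orbit is known from a_i and c_i = |b_i|^2, and a_0 from the
    trace.  Hence the orbit space is homeomorphic to the compact set
    [model_space] of the pairs (a, c) with c >= 0 and
      prod_j (X - lam_j)
        = (X - a_0) prod_i (X - a_i) - sum_i c_i prod_(k <> i) (X - a_k);
    a continuous inverse sends (a, c) to the real matrix with b_i = sqrt c_i.

    The image of the diagonal map (a, c) |-> a is the union of the boxes: it lies
    there by interlacing ([model_in_box]), and it is everything by an explicit
    construction of weights ([box_model]).  If a_i differs from all other
    entries, c_i is determined by a.  No three entries are equal; two equal ones
    are equal to some lam_j, and only the sum c_i + c_k is determined.  So the
    fibre over a is a product of segments, one for each pair of equal entries,
    and no section of the diagonal map is continuous at a crossing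
    a_i = a_k = lam_j of two boxes: near it, with u = lam_j - a_i and
    v = a_k - lam_j, the ratio c_i : c_k behaves like u : v.

    The remedy is to move the diagonal first.  The homotopy [push] replaces
    (u, v) by (u + t v, v + t u) near the crossing, with a cut-off.  It lifts to
    the model, the ratio u : v being moved in the same way also when u = v = 0.
    At t = 1 the ratio tends to 1 at the crossing, so that the end of the
    lifted homotopy [deform] depends on a only; it defines the homotopy inverse
    [model_lift].  The lift is described by equations between (a, c), t and
    (a', c') that have exactly one solution; its continuity is then the closed
    graph theorem.

    Finally the boxes retract onto the cubical faces up to homotopy.  A face of
    the permutohedron is a product over blocks, and a cubical face consists of
    the x such that a block {i} at position N + 1 has x_i = N + 1, and a block {i, k}
    at positions N + 1, N + 2 has x_i + x_k = 2 N + 3 with both entries between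
    N + 1 and N + 2 ([cubical_complexP]).  The rank vector of a point of the
    boxes is not continuous, but [soft_rank], which counts the entries below a_i
    with a ramp instead of a step, is; when the ramp is short the entries
    interact in disjoint pairs and the soft ranks form a point of a cubical face.
    In the other direction [center_line] maps [N + 1/2, N + 3/2] to the interval
    I_(N+1).  Both composites are joined to the identity by straight segments,
    inside a box and inside a face. *)

Local Open Scope classical_set_scope.
Local Open Scope ring_scope.
Local Open Scope complex_scope.

Set Implicit Arguments.
Unset Strict Implicit.
Unset Printing Implicit Defensive.

(** * Continuity and homotopies *)

Section Topology.

Definition to_sub (X : Type) (A : set X) (x : X) (Ax : A x) : A :=
  exist (fun x => x \in A) x (mem_set Ax).

Lemma val_continuous (X : topologicalType) (A : set X) :
  continuous (set_val : A -> X).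
Proof. exact: (@initial_continuous A X set_val). Qed.

Lemma continuous_to_sub (X Y : topologicalType) (A : set Y) (f : X -> A) :
  continuous (set_val \o f) -> continuous f.
Proof. exact: continuous_comp_initial. Qed.

Lemma compact_sub (X : topologicalType) (A : set X) :
  compact A -> compact [set: A].
Proof.
move=> cA F FF _.
have FA : (set_val @ F) A.
  by apply: (@filterS _ F _ setT) => [x _|]; [exact: set_valP|exact: filterT].
have [x [Ax clx]] := cA _ (fmap_proper_filter _ FF) FA.
exists (exist _ x (mem_set Ax)); split => // B U FB.
rewrite nbhsE => -[_ [[V oV <-] Vx] VU].
have [_ [[b Bb <-] Vb]] : (set_val @` B) `&` V !=set0.
  apply: clx; first by apply: (@filterS _ F _ B) => // b Bb; exists b.
  by apply: open_nbhs_nbhs; split.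
by exists b; split => //; exact: VU.
Qed.

(** Closed graph theorem with values in a compact set: a point of [C] other than
    [f x] has a neighbourhood that the graph avoids near [x], and finitely many
    such neighbourhoods cover [C] outside a given neighbourhood of [f x]. *)
Lemma closed_graph_continuous (X Y : topologicalType) (C : set Y)
    (G : set (X * Y)) (f : X -> Y) :
  compact C -> closed G -> (forall x, C (f x)) -> (forall x, G (x, f x)) ->
  (forall x y, C y -> G (x, y) -> y = f x) -> continuous f.
Proof.
move=> /compact_near_coveringP cC clG Cf Gf funG x U /= Ufx.
suff Vx : \forall x' \near x, C `<=` (fun y => G (x', y) -> U y).
  by apply: filterS Vx => x' /(_ _ (Cf x')); apply; exact: Gf.
apply: cC => y Cy.
have [yfx|yfx] := pselect (y = f x).
  exists (U, [set: X]) => /=; last by move=> [a b] /= [].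
  by rewrite yfx; split; [exact: Ufx|exact: filterT].
have nG : ~ G (x, y) by move=> /(funG _ _ Cy).
have : nbhs (x, y) (~` G) by apply: open_nbhs_nbhs; split => //; exact: closed_openC.
case=> -[V W] /= [Vx Wy] VW.
by exists (W, V) => //= -[a b] /= [Wa Vb] Gba; case: (VW (b, a)).
Qed.

(** A continuous surjection from a compact space to a Hausdorff space is closed,
    hence a quotient map. *)
Lemma compact_surj_continuous (X Y Z : topologicalType) (A : set X) (B : set Y)
    (g : A -> B) (f : B -> Z) :
  compact A -> hausdorff_space Y -> continuous g -> (forall y, exists x, g x = y) ->
  continuous (f \o g) -> continuous f.
Proof.
move=> cA hY cg sg cfg; apply/continuous_closedP => D cD.
pose E := (f \o g) @^-1` D.
have cE : compact E.
  apply: (@subclosed_compact _ _ [set: A]) => //; last exact: compact_sub.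
  by move/continuous_closedP : cfg; apply.
have cvg : continuous (set_val \o g).
  by move=> x; apply: continuous_comp; [exact: cg|exact: val_continuous].
have clE : closed ((set_val \o g) @` E).
  apply: compact_closed => //; apply: continuous_compact => //.
  exact: continuous_subspaceT.
have -> : f @^-1` D = set_val @^-1` ((set_val \o g) @` E).
  apply/seteqP; split=> [y Dy|y [x Ex] /= gxy] /=.
    by have [x xy] := sg y; exists x => //=; rewrite /E /= xy.
  by have -> : y = g x by apply: val_inj.
by have /continuous_closedP := @val_continuous _ B; apply.
Qed.

Lemma cont_id (X : topologicalType) : continuous (fun x : X => x).
Proof. by move=> x. Qed.

Lemma closed_forall (X : topologicalType) (I : Type) (P : I -> set X) :
  (forall i, closed (P i)) -> closed [set x | forall i, P i x].
Proof.
move=> cP; have -> : [set x | forall i, P i x] = \bigcap_i P i.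
  by apply/seteqP; split=> x /= h i => [_|]; apply: h.
exact: closed_bigI.
Qed.

Lemma hausdorff_rV (R : realType) n : hausdorff_space 'rV[R]_n.
Proof.
case: n => [|n]; first by move=> x y _; rewrite [x]thinmx0 [y]thinmx0.
exact: norm_hausdorff.
Qed.

Lemma row_ord0 (T : Type) n (f : 'I_n -> T) : (\row_i f i) ord0 = f.
Proof. by apply/funext => i; rewrite mxE. Qed.

Lemma continuous_mx (X : topologicalType) (T : topologicalType) m n
    (f : X -> 'M[T]_(m, n)) :
  (forall i j, continuous (fun x => f x i j)) -> continuous f.
Proof.
move=> cf x U [P Pf PU].
have : \forall y \near x, forall i j, P i j (f y i j).
  apply: filter_forall => i; apply: filter_forall => j; exact: cf.
by apply: filterS => y Py; exact: PU.
Qed.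

End Topology.

Section Combinators.
Context {R : realType} {X Y Z : topologicalType}.

Lemma cont_comp (f : X -> Y) (g : Y -> Z) :
  continuous g -> continuous f -> continuous (fun x => g (f x)).
Proof. by move=> cg cf x; apply: continuous_comp; [exact: cf|exact: cg]. Qed.

Lemma cont_pair (f : X -> Y) (g : X -> Z) :
  continuous f -> continuous g -> continuous (fun x => (f x, g x)).
Proof.
move=> cf cg x U [[V W] /= [Vf Wg] VW].
have : nbhs x ((f @^-1` V) `&` (g @^-1` W)).
  by apply: filterI; [exact: (cf x V Vf)|exact: (cg x W Wg)].
by apply: filterS => y [? ?]; exact: VW.
Qed.

Lemma cont_fst : continuous (fst : X * Y -> X).
Proof. by move=> x; exact: cvg_fst. Qed.

Lemma cont_snd : continuous (snd : X * Y -> Y).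
Proof. by move=> x; exact: cvg_snd. Qed.

Lemma cont_cst (y : Y) : continuous (fun _ : X => y).
Proof. by move=> x; exact: cvg_cst. Qed.

Implicit Types f g : X -> R.

Lemma cont_add f g : continuous f -> continuous g -> continuous (fun x => f x + g x).
Proof. by move=> cf cg x; apply: cvgD; [exact: cf|exact: cg]. Qed.

Lemma cont_opp f : continuous f -> continuous (fun x => - f x).
Proof. by move=> cf x; apply: cvgN; exact: cf. Qed.

Lemma cont_sub f g : continuous f -> continuous g -> continuous (fun x => f x - g x).
Proof. by move=> cf cg; apply: cont_add => //; exact: cont_opp. Qed.

Lemma cont_mul f g : continuous f -> continuous g -> continuous (fun x => f x * g x).
Proof. by move=> cf cg x; apply: cvgM; [exact: cf|exact: cg]. Qed.

Lemma cont_max f g :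
  continuous f -> continuous g -> continuous (fun x => Num.max (f x) (g x)).
Proof.
by move=> cf cg x; apply: (@continuous_max R X f g x); [exact: cf|exact: cg].
Qed.

Lemma cont_min f g :
  continuous f -> continuous g -> continuous (fun x => Num.min (f x) (g x)).
Proof.
by move=> cf cg x; apply: (@continuous_min R X f g x); [exact: cf|exact: cg].
Qed.

Lemma cont_norm f : continuous f -> continuous (fun x => `|f x|).
Proof. by move=> cf x; apply: cvg_norm; exact: cf. Qed.

Lemma cont_sum (I : Type) (r : seq I) (P : pred I) (F : I -> X -> R) :
  (forall i, P i -> continuous (F i)) ->
  continuous (fun x => \sum_(i <- r | P i) F i x).
Proof. by move=> cF; apply: continuous_big => //; exact: add_continuous. Qed.

Lemma cont_prod (I : Type) (r : seq I) (P : pred I) (F : I -> X -> R) :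
  (forall i, P i -> continuous (F i)) ->
  continuous (fun x => \prod_(i <- r | P i) F i x).
Proof. by move=> cF; apply: continuous_big => //; exact: mul_continuous. Qed.

Lemma cont_coord m n i j (f : X -> 'M[R]_(m, n)) :
  continuous f -> continuous (fun x => f x i j).
Proof.
move=> cf x; apply: (@continuous_comp X _ _ f (fun M => M i j) x); first exact: cf.
exact: coord_continuous.
Qed.

Lemma closed_eq_fun f g :
  continuous f -> continuous g -> closed [set x | f x = g x].
Proof.
move=> cf cg; have -> : [set x | f x = g x] = [set x | f x - g x = 0].
  by apply/seteqP; split=> x /= => [->|/eqP]; rewrite ?subrr// subr_eq0 => /eqP.
by have /continuous_closedP/(_ _ (@closed_eq R 0)) := cont_sub cf cg.
Qed.

End Combinators.

Section Homotopy.
Variable R : realType.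

(** Composing the time of a homotopy with [clamp] makes it defined and continuous
    for all real times. *)
Definition clamp (t : R) : R := Num.max 0 (Num.min 1 t).

Lemma clamp_ge0 t : 0 <= clamp t.
Proof. by rewrite le_max lexx. Qed.

Lemma clamp_le1 t : clamp t <= 1.
Proof. by rewrite ge_max ler01 ge_min lexx. Qed.

Lemma clampE t : 0 <= t -> t <= 1 -> clamp t = t.
Proof. by move=> t0 t1; rewrite /clamp (min_idPr t1) (max_idPr t0). Qed.

Lemma clamp0 t : t <= 0 -> clamp t = 0.
Proof. by move=> t0; rewrite /clamp; apply/max_idPl; rewrite ge_min t0 orbT. Qed.

Lemma clamp1 t : 1 <= t -> clamp t = 1.
Proof. by move=> t1; rewrite /clamp (min_idPl t1); apply/max_idPr. Qed.

Lemma clamp_continuous : continuous clamp.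
Proof.
apply: cont_max; first exact: cont_cst.
by apply: cont_min; [exact: cont_cst | move=> ?].
Qed.

Lemma le_clamp : {homo clamp : s t / s <= t}.
Proof.
move=> s t st; rewrite /clamp ge_max; rewrite le_max lexx /= le_max.
by rewrite !le_min !ge_min lexx st /= !orbT.
Qed.

(** Homotopies that are continuous for all real times are easier to combine
    than those continuous within [0, 1]; [homotopic_totalW] returns to the latter. *)
Definition homotopic_total (X Y : topologicalType) (f g : X -> Y) : Prop :=
  exists H : X * R -> Y,
    [/\ continuous H, forall x, H (x, 0) = f x & forall x, H (x, 1) = g x].

Lemma homotopic_totalW (X Y : topologicalType) (f g : X -> Y) :
  homotopic_total f g -> homotopic R f g.
Proof.
by move=> [H [cH H0 H1]]; exists H; split=> //; exact: continuous_subspaceT.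
Qed.

Lemma homotopic_total_sym (X Y : topologicalType) (f g : X -> Y) :
  homotopic_total f g -> homotopic_total g f.
Proof.
move=> [H [cH H0 H1]]; exists (H \o (fun z => (z.1, 1 - z.2))); split=> /=.
- apply: cont_comp cH _; apply: cont_pair; first exact: cont_fst.
  by apply: cont_sub; [exact: cont_cst|exact: cont_snd].
- by move=> x; rewrite subr0.
- by move=> x; rewrite subrr.
Qed.

Lemma homotopic_total_comp (X Y Z T: topologicalType) (f g : X -> Y) (u : Y -> Z) (v : T -> X):
  continuous u -> continuous v -> homotopic_total f g -> homotopic_total (u \o f \o v) (u \o g \o v).
Proof.
move=> cu cv [H [cH H0 H1]].
exists (fun z => u (H (v z.1, z.2))); split=> /=; last 2 first.
- by move=> x; rewrite H0.
- by move=> x; rewrite H1.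
apply: (cont_comp cu); apply: (cont_comp cH); apply: cont_pair.
  exact: cont_comp cv cont_fst.
exact: cont_snd.
Qed.

Lemma homotopic_total_trans (X Y : topologicalType) (f g h : X -> Y) :
  homotopic_total f g -> homotopic_total g h -> homotopic_total f h.
Proof.
move=> [H [cH H0 H1]] [K [cK K0 K1]].
pose H' (z : X * R) := H (z.1, clamp (2 * z.2)).
pose K' (z : X * R) := K (z.1, clamp (2 * z.2 - 1)).
have cH' : continuous H'.
  apply: (cont_comp cH); apply: cont_pair; first exact: cont_fst.
  apply: (cont_comp clamp_continuous).
  by apply: cont_mul; [exact: cont_cst|exact: cont_snd].
have cK' : continuous K'.
  apply: (cont_comp cK); apply: cont_pair; first exact: cont_fst.
  apply: (cont_comp clamp_continuous).
  apply: cont_sub; last exact: cont_cst.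
  by apply: cont_mul; [exact: cont_cst|exact: cont_snd].
pose L z := if z.2 <= 2^-1 then H' z else K' z.
have LH z : z.2 <= 2^-1 -> L z = H' z by rewrite /L => ->.
have LK z : 2^-1 <= z.2 -> L z = K' z.
  rewrite /L /H' /K'; case: ifPn => // z1 z2.
  have -> : z.2 = 2^-1 by apply/eqP; rewrite eq_le z1.
  by rewrite mulfV ?pnatr_eq0// subrr clamp1// clamp0// H1 K0.
exists L; split; last 2 first.
- by move=> x; rewrite LH/= ?invr_ge0// /H'/= mulr0 clamp0.
- move=> x; rewrite LK/= ?invf_le1 ?ler1n// /K'/= mulr1 clamp1//.
  by rewrite lerBrDr.
apply/continuous_closedP => D cD.
have -> : L @^-1` D = ((snd @^-1` [set t | t <= 2^-1]) `&` H' @^-1` D) `|`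
                      ((snd @^-1` [set t | t >= 2^-1]) `&` K' @^-1` D).
  apply/seteqP; split=> z /=.
    have [z1|z1] := leP z.2 2^-1; first by rewrite LH//; left.
    by rewrite LK ?ltW//; right; split=> //; exact: ltW.
  by case=> -[z1]; rewrite ?(LH _ z1) ?(LK _ z1).
have cs : continuous (snd : X * R -> R) by move=> z; exact: cvg_snd.
apply: closedU; apply: closedI.
- by move/continuous_closedP : cs; apply; exact: closed_le.
- by move/continuous_closedP : cH'; apply.
- by move/continuous_closedP : cs; apply; exact: closed_ge.
- by move/continuous_closedP : cK'; apply.
Qed.

Lemma segment_continuous (X : topologicalType) n (A : set 'rV[R]_n) (f g : X -> A) :
  continuous f -> continuous g ->
  continuous (fun z : X * R => clamp z.2 *: set_val (f z.1) + (1 - clamp z.2) *: set_val (g z.1)).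
Proof.
move=> cf cg; apply: continuous_mx => i j.
under eq_fun do rewrite !mxE.
have ct : continuous (fun z : X * R => clamp z.2).
  by apply: (cont_comp clamp_continuous); exact: cont_snd.
have cv (h : X -> A) : continuous h -> continuous (fun z : X * R => (set_val (h z.1)) i j).
  move=> ch; apply: cont_coord; apply: (cont_comp (@val_continuous _ _)).
  by apply: (cont_comp ch); exact: cont_fst.
apply: cont_add; apply: cont_mul => //; try exact: cv.
by apply: cont_sub => //; exact: cont_cst.
Qed.

Lemma segment_homotopic (X : topologicalType) n (A : set 'rV[R]_n) (f g : X -> A) :
  continuous f -> continuous g ->
  (forall x t, 0 <= t -> t <= 1 -> A (t *: set_val (f x) + (1 - t) *: set_val (g x))) ->
  homotopic_total f g.
Proof.
move=> cf cg fgA; apply: homotopic_total_sym.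
exists (fun z => to_sub (fgA z.1 (clamp z.2) (clamp_ge0 _) (clamp_le1 _))); split.
- by apply: continuous_to_sub; exact: segment_continuous.
- by move=> x; apply: val_inj; rewrite /= clamp0// scale0r add0r subr0 scale1r.
- by move=> x; apply: val_inj; rewrite /= clamp1// scale1r subrr scale0r addr0.
Qed.

End Homotopy.

(** * Characteristic polynomials of arrow matrices *)

Section ArrowPoly.
Variables (F : fieldType) (n : nat).
Implicit Types (a c : 'I_n -> F) (lam : 'I_n.+1 -> F) (t : F).

Definition diag_poly a : {poly F} := \prod_i ('X - (a i)%:P).

Definition codiag_poly a i : {poly F} := \prod_(k | k != i) ('X - (a k)%:P).

(** The characteristic polynomial of the arrow matrix with diagonal [t], [a] and
    products of opposite off-diagonal entries [c]; see [char_poly_arrow]. *)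
Definition arrow_poly t a c : {poly F} :=
  ('X - t%:P) * diag_poly a - \sum_i (c i)%:P * codiag_poly a i.

Definition spectral_poly lam : {poly F} := \prod_j ('X - (lam j)%:P).

(** The entry of index 0 of an arrow matrix is forced by the trace; see
    [corner_unique]. *)
Definition corner lam a : F := \sum_j lam j - \sum_i a i.

Definition gaps a i : F := \prod_(k | k != i) (a i - a k).

Definition gaps2 a i k : F := \prod_(l | (l != i) && (l != k)) (a i - a l).

Definition spectral_cofactor lam j (z : F) : F := \prod_(m | m != j) (z - lam m).

Lemma diag_polyE a i : diag_poly a = ('X - (a i)%:P) * codiag_poly a i.
Proof. by rewrite /diag_poly (bigD1 i). Qed.

Lemma horner_diag_poly a z : (diag_poly a).[z] = \prod_i (z - a i).
Proof. by rewrite horner_prod; apply: eq_bigr => i _; rewrite !hornerE. Qed.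

Lemma horner_codiag_poly a i z :
  (codiag_poly a i).[z] = \prod_(k | k != i) (z - a k).
Proof. by rewrite horner_prod; apply: eq_bigr => k _; rewrite !hornerE. Qed.

Lemma horner_arrow_poly t a c z : (arrow_poly t a c).[z] =
  (z - t) * \prod_i (z - a i) - \sum_i c i * \prod_(k | k != i) (z - a k).
Proof.
rewrite /arrow_poly !hornerE horner_diag_poly horner_sum; congr (_ - _).
by apply: eq_bigr => i _; rewrite !hornerE horner_codiag_poly.
Qed.

Lemma codiag_poly_eq a i k : a i = a k -> codiag_poly a i = codiag_poly a k.
Proof.
move=> aik; have : diag_poly a = diag_poly a by [].
rewrite {1}(diag_polyE a i) (diag_polyE a k) aik => /mulfI; apply.
by rewrite polyXsubC_eq0.
Qed.

Lemma gapsE a i k : i != k -> gaps a i = (a i - a k) * gaps2 a i k.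
Proof.
by move=> ik; rewrite /gaps (bigD1 k) 1?eq_sym//=.
Qed.

Lemma gaps_simple a i : (forall k, k != i -> a k != a i) -> gaps a i != 0.
Proof. by move=> ai; apply/prodf_neq0 => k /ai; rewrite subr_eq0 eq_sym. Qed.

Lemma arrow_poly_at t a c i : (arrow_poly t a c).[a i] = - c i * gaps a i.
Proof.
rewrite horner_arrow_poly [\prod_(_ < n) _](bigD1 i)//= subrr mul0r mulr0 sub0r.
rewrite [\sum_(_ < n) _](bigD1 i)//= [\sum_(_ < n | _) _]big1 ?addr0 ?mulNr// => k ki.
by rewrite (bigD1 i) 1?eq_sym//= subrr mul0r mulr0.
Qed.

Lemma horner_deriv_root (p : {poly F}) z : ((('X - z%:P) * p)^`()).[z] = p.[z].
Proof. by rewrite derivM derivXsubC mul1r !hornerE subrr mul0r addr0. Qed.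

(** At a double entry of the diagonal all terms vanish, and the derivative only
    sees the two terms in which one of the two equal factors is missing. *)
Lemma arrow_poly_deriv_at t a c i k : i != k -> a i = a k ->
  (arrow_poly t a c)^`().[a i] = - (c i + c k) * gaps2 a i k.
Proof.
move=> ik aik.
have E l : codiag_poly a l = ('X - (a i)%:P) *
    (if l == i then \prod_(m | (m != i) && (m != k)) ('X - (a m)%:P)
     else \prod_(m | (m != l) && (m != i)) ('X - (a m)%:P)).
  rewrite /codiag_poly; case: eqVneq => [->|li]; last by rewrite (bigD1 i) 1?eq_sym.
  by rewrite (bigD1 k) 1?eq_sym//= aik.
rewrite /arrow_poly (diag_polyE a i) mulrCA derivB hornerD hornerN horner_deriv_root.
rewrite hornerM horner_codiag_poly (bigD1 k) 1?eq_sym//= aik subrr mul0r mulr0 sub0r.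
rewrite raddf_sum horner_sum mulNr; congr (- _).
under eq_bigr do rewrite E mulrCA -aik horner_deriv_root hornerM hornerC.
have H l : l != i -> l != k ->
    (\prod_(m | (m != l) && (m != i)) ('X - (a m)%:P)).[a i] = 0.
  move=> li lk; rewrite horner_prod (bigD1 k) /=; last by rewrite eq_sym lk eq_sym.
  by rewrite !hornerE aik subrr mul0r.
rewrite [\sum_(_ < n) _](bigD1 i)//= [\sum_(_ < n | _) _](bigD1 k) 1?eq_sym//=.
rewrite eqxx (negPf ik) [\sum_(_ < n | _) _]big1 ?addr0; last first.
  by move=> l /andP[li lk]; rewrite (negPf li) H// mulr0.
rewrite mulrDl; congr (_ * _ + _ * _); rewrite horner_prod /gaps2.
  by apply: eq_bigr => l _; rewrite !hornerE.
by apply: eq_big => [l|l _]; [rewrite andbC|rewrite !hornerE].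
Qed.

Lemma horner_spectral_poly lam z : (spectral_poly lam).[z] = \prod_j (z - lam j).
Proof. by rewrite horner_prod; apply: eq_bigr => i _; rewrite !hornerE. Qed.

Lemma spectral_cofactorE lam j z :
  (spectral_poly lam).[z] = (z - lam j) * spectral_cofactor lam j z.
Proof. by rewrite horner_spectral_poly (bigD1 j). Qed.

Lemma deriv_spectral_poly lam j :
  (spectral_poly lam)^`().[lam j] = spectral_cofactor lam j (lam j).
Proof.
rewrite /spectral_poly (bigD1 j)//= horner_deriv_root horner_prod.
by apply: eq_bigr => i _; rewrite !hornerE.
Qed.

Lemma size_diag_poly a : size (diag_poly a) = n.+1.
Proof. by rewrite size_prod_XsubC /index_enum -enumT size_enum_ord. Qed.

Lemma size_codiag_poly a i : size (codiag_poly a i) = n.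
Proof.
have := size_diag_poly a; rewrite (diag_polyE a i) size_monicM ?monicXsubC//.
  by rewrite size_XsubC => -[].
by apply/monic_neq0/monic_prod_XsubC.
Qed.

Lemma arrow_poly_coef t a c : (arrow_poly t a c)`_n = - (t + \sum_i a i).
Proof.
rewrite coefB coef_sum big1 ?subr0 => [|i _]; last first.
  by rewrite coefCM nth_default ?mulr0// size_codiag_poly.
have -> : ('X - t%:P) * diag_poly a =
    \prod_(x <- t :: [seq a i | i <- index_enum 'I_n]) ('X - x%:P).
  by rewrite big_cons big_map.
have sz : size (t :: [seq a i | i <- index_enum 'I_n]) = n.+1.
  by rewrite /= size_map /index_enum -enumT size_enum_ord.
rewrite -[X in _`_X](congr1 predn sz) coefPn_prod_XsubC ?sz//.
by rewrite big_cons big_map.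
Qed.

Lemma spectral_poly_coef lam : (spectral_poly lam)`_n = - \sum_j lam j.
Proof.
have -> : spectral_poly lam =
    \prod_(x <- [seq lam j | j <- index_enum 'I_n.+1]) ('X - x%:P).
  by rewrite big_map.
have sz : size [seq lam i | i <- index_enum 'I_n.+1] = n.+1.
  by rewrite size_map /index_enum -enumT size_enum_ord.
by rewrite -[X in _`_X](congr1 predn sz) coefPn_prod_XsubC ?sz// big_map.
Qed.

Lemma corner_unique lam t a c :
  arrow_poly t a c = spectral_poly lam -> t = corner lam a.
Proof.
move=> /(congr1 (fun p : {poly F} => p`_n)).
by rewrite arrow_poly_coef spectral_poly_coef /corner => /oppr_inj <-; rewrite addrK.
Qed.

End ArrowPoly.

(** * Interlacing from sign conditions *)

Section RankPerm.
Variable n : nat.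

Lemma card_perm_lt (s : 'S_n) m : (m <= n)%N -> #|[pred k | (s k < m)%N]| = m.
Proof.
move=> mn; transitivity #|[set k : 'I_n | (k < m)%N]%SET|.
  rewrite -(card_preimset _ (@perm_inj _ s)); apply: eq_card => k.
  by rewrite !inE.
rewrite cardsE -sum1_card -(big_ord_widen n (fun=> 1%N) mn).
by rewrite sum_nat_const card_ord muln1.
Qed.

(** The permutation sending each index to the number of indices below it. *)
Lemma rank_perm (lt : rel 'I_n) :
  irreflexive lt -> transitive lt -> (forall i k, i != k -> lt i k || lt k i) ->
  exists s : 'S_n, forall i k, (s i < s k)%N = lt i k.
Proof.
move=> irr tr tot.
pose r i := #|[pred k | lt k i]|.
have rlt i k : lt i k -> (r i < r k)%N.
  move=> ik; apply: proper_card; apply/properP; split.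
    apply/fintype.subsetP => m; rewrite !inE => mi; exact: tr mi ik.
  by exists i; rewrite !inE ?irr.
have rn i : (r i < n)%N.
  rewrite -[X in (_ < X)%N]card_ord; apply: proper_card; apply/properP.
  by split; [exact: subset_predT | exists i; rewrite !inE ?irr].
have rinj : injective (fun i => Ordinal (rn i)).
  move=> i k /(congr1 val)/= rik; apply/eqP/negPn/negP => /tot.
  by case/orP => /rlt; rewrite rik ltnn.
exists (perm rinj) => i k; rewrite !permE /=.
apply/idP/idP => [|/rlt//].
have [->|/tot/orP[//|/rlt]] := eqVneq i k; first by rewrite ltnn.
by move=> /ltnW; rewrite leqNgt => /negPf->.
Qed.

Lemma card_ord_lt p : (p <= n)%N -> #|[pred j : 'I_n | (j < p)%N]| = p.
Proof.
move=> /(card_perm_lt 1); rewrite -[RHS]/(p) => E; rewrite -[RHS]E.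
by apply: eq_card => j; rewrite !inE perm1.
Qed.

End RankPerm.

Section Interlacing.
Variable R : realFieldType.
Implicit Types (s ls xs : seq R) (l : R).

Lemma exists_max_seq s : s != [::] -> exists2 m, m \in s & forall x, x \in s -> x <= m.
Proof.
elim: s => // x s IHs _; have [->|/IHs[m ms mmax]] := eqVneq s [::].
  by exists x => [|y]; rewrite ?inE// => /eqP->.
have [xm|mx] := leP x m.
  by exists m => [|y]; rewrite inE ?ms ?orbT// => /orP[/eqP->|/mmax].
exists x => [|y]; rewrite inE ?eqxx// => /orP[/eqP->//|/mmax/le_trans].
by apply; exact: ltW.
Qed.

Lemma sign_prod_sub s l : l \notin s ->
  0 < (-1) ^+ count (fun x => l < x) s * \prod_(x <- s) (l - x).
Proof.
elim: s => [_|x s IHs]; first by rewrite big_nil mulr1 expr0.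
rewrite inE negb_or big_cons /= => /andP[lx /IHs].
have [ltlx|ltxl|eqlx] := ltgtP l x; last by rewrite eqlx eqxx in lx.
  rewrite exprS mulN1r mulNr => H.
  by rewrite mulrCA -mulNr opprB mulr_gt0// subr_gt0.
by rewrite add0n mulrCA => H; rewrite mulr_gt0// subr_gt0.
Qed.

Lemma exists_pred_seq ls l : uniq ls -> l \in ls ->
  (forall x, x \in ls -> l <= x) \/
  exists l1, [/\ l1 \in ls, l1 < l & count (fun x => l1 < x) ls =
                                    (count (fun x => l < x)%R ls).+1].
Proof.
move=> uls lls; have [s0|] := eqVneq [seq x <- ls | x < l] [::].
  left=> x xls; rewrite leNgt; apply/negP => xl.
  by have : x \in [::] by rewrite -s0 mem_filter xl.
move=> /exists_max_seq[l1]; rewrite mem_filter => /andP[l1l l1ls] l1max; right.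
exists l1; split=> //.
have /eq_in_count-> : {in ls, (fun x => l1 < x) =1 predU (pred1 l) (fun x => l < x)}.
  move=> x xls /=; rewrite [x == l]eq_sym -le_eqVlt; apply/idP/idP => [l1x|].
    by rewrite leNgt; apply/negP => xl; move: l1x; rewrite ltNge l1max// mem_filter xl.
  exact: lt_le_trans.
have := count_predUI (pred1 l) (fun x => l < x) ls.
rewrite (@eq_count _ (predI _ _) pred0) => [|x]; last first.
  by apply/negbTE/negP => /andP[/eqP->]; rewrite ltxx.
by rewrite count_pred0 addn0 => ->; rewrite (count_uniq_mem _ uls) lls.
Qed.

(** Interlacing from signs.  If the two lists are disjoint, the hypothesis says
    that the numbers of elements of [xs] and of [ls] above [l] have the same
    parity; passing from [l] to its predecessor in [ls] adds one to the second
    number and cannot decrease the first, so by induction the first never exceeds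
    the second.  A common element may be removed from both lists: the
    hypothesis is divided by a square. *)
Lemma count_gt_le ls xs : uniq ls -> size ls = (size xs).+1 ->
  (forall l, l \in ls ->
     0 <= \prod_(x <- xs) (l - x) * \prod_(m <- ls | m != l) (l - m)) ->
  forall l, l \in ls ->
    (count (fun x => l < x)%R xs <= count (fun x => l < x)%R ls)%N.
Proof.
elim: {xs}(size xs) {-2}xs (erefl (size xs)) ls => [|p IHp] xs szxs ls uls szls sgn.
  by move=> l lls; rewrite (size0nil szxs).
have allgt l s : {in s, forall x, l < x} -> count (fun x => l < x) s = size s.
  by move=> ls0; apply/eqP; rewrite -all_count; apply/allP.
have [/hasP[l0 l0ls l0xs]|/hasPn disj] := boolP (has (mem xs) ls).
  pose ls' := rem l0 ls; pose xs' := rem l0 xs.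
  have pls : perm_eq ls (l0 :: ls') by exact: perm_to_rem.
  have pxs : perm_eq xs (l0 :: xs') by exact: perm_to_rem.
  have uls' : uniq ls' by exact: rem_uniq.
  have memls' x : (x \in ls') = (x != l0) && (x \in ls).
    by rewrite /ls' mem_rem_uniq.
  have szxs' : size xs' = p by rewrite size_rem// szxs.
  have szls' : size ls' = (size xs').+1 by rewrite size_rem// szls szxs szxs'.
  have IH : forall l, l \in ls' ->
      (count (fun x => l < x)%R xs' <= count (fun x => l < x)%R ls')%N.
    apply: (IHp _ szxs' _ uls' szls') => l; rewrite memls' => /andP[ll0 lls].
    have := sgn l lls; rewrite (perm_big _ pxs) (perm_big _ pls) !big_cons.
    rewrite eq_sym ll0 mulrACA -expr2 pmulr_rge0// exprn_even_gt0//=.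
    by rewrite subr_eq0.
  have cnt l : (count (fun x => l < x)%R xs' <= count (fun x => l < x)%R ls')%N ->
      (count (fun x => l < x)%R xs <= count (fun x => l < x)%R ls)%N.
    have /seq.permP-> := pxs; have /seq.permP-> := pls.
    by rewrite /= leq_add2l.
  move=> l lls; apply: cnt; have [->{l lls}|ll0] := eqVneq l l0; last first.
    by apply: IH; rewrite memls' ll0.
  have [lmin|[l1 [l1ls l1l0 cntl1]]] := exists_pred_seq uls l0ls.
    rewrite (@allgt _ ls') ?szls'; last first.
      by move=> x; rewrite memls' lt_neqAle eq_sym => /andP[-> /lmin].
    by apply: leq_trans (leqnSn _); exact: count_size.
  have l1ls' : l1 \in ls' by rewrite memls' l1ls andbT lt_eqF.
  apply: leq_trans (leq_trans (IH _ l1ls') _).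
    by apply: sub_count => x /=; exact: lt_trans.
  move: cntl1; have /seq.permP-> := pls; have /seq.permP-> := pls.
  by rewrite /= l1l0 ltxx add1n => -[->].
have par l : l \in ls ->
    odd (count (fun x => l < x)%R xs) = odd (count (fun x => l < x)%R ls).
  move=> lls; have := sgn l lls; rewrite -[X in _ * X]big_filter.
  have /sign_prod_sub s1 := disj _ lls.
  have /sign_prod_sub s2 : l \notin [seq m <- ls | m != l].
    by rewrite mem_filter eqxx.
  move=> s3; have := mulr_gt0 s1 s2.
  rewrite mulrACA -signr_odd -(signr_odd _ (count _ [seq _ <- _ | _])).
  have -> : count (fun x => l < x)%R [seq m <- ls | m != l] = count (fun x => l < x)%R ls.
    rewrite count_filter; apply: eq_count => x /=.
    by case: ltgtP.
  case: (odd (count _ xs)); case: (odd _) => //=;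
    by rewrite !(expr0, expr1, mulN1r, mul1r, mulr1, mulrN1) ltNge oppr_le0 s3.
move=> l; have [d] := ubnP (size ls - count (fun x => l < x)%R ls).
elim: d => // d IHd in l *; rewrite ltnS => dl lls.
have [lmin|[l1 [l1ls l1l cntl1]]] := exists_pred_seq uls lls.
  have := count_predC (pred1 l) ls; rewrite (count_uniq_mem _ uls) lls szls.
  rewrite add1n => -[szE]; apply: leq_trans (count_size _ _) _; rewrite -szE.
  rewrite leq_eqVlt; apply/orP; left; apply/eqP/eq_in_count => x xls /=.
  by rewrite lt_neqAle lmin// andbT eq_sym.
have le1 : (count (fun x => l1 < x)%R xs <= (count (fun x => l < x)%R ls).+1)%N.
  rewrite -cntl1; apply: IHd => //; apply: leq_trans dl; rewrite cntl1 subnS prednK//.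
  by rewrite subn_gt0 (leq_trans _ (count_size (fun x => l1 < x) ls))// cntl1.
have : (count (fun x => l < x)%R xs <= (count (fun x => l < x)%R ls).+1)%N.
  by apply: leq_trans le1; apply: sub_count => x /=; exact: lt_trans.
rewrite leq_eqVlt => /orP[/eqP NM|]; last by rewrite ltnS.
by have := par _ lls; rewrite NM /=; case: odd.
Qed.

(** The previous lemma for the opposite numbers. *)
Lemma count_lt_le ls xs : uniq ls -> size ls = (size xs).+1 ->
  (forall l, l \in ls ->
     0 <= \prod_(x <- xs) (l - x) * \prod_(m <- ls | m != l) (l - m)) ->
  forall l, l \in ls ->
    (count (fun x => x < l)%R xs <= count (fun x => x < l)%R ls)%N.
Proof.
move=> uls szls sgn l lls.
have cN s : count (fun x => x < l) s = count (fun x => - l < x) [seq - x | x <- s].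
  by rewrite count_map; apply: eq_count => x /=; rewrite ltrN2.
rewrite !cN; apply: count_gt_le; last exact: map_f.
- by rewrite map_inj_uniq//; exact: oppr_inj.
- by rewrite !size_map.
move=> _ /mapP[k kls ->]; have := sgn k kls.
rewrite !big_map.
have -> : \prod_(j <- ls | - j != - k) (- k - - j) = \prod_(j <- ls | j != k) (- k - - j).
  by apply: eq_bigl => m; rewrite eqr_opp.
have prN (P : pred R) s : \prod_(x <- s | P x) (- k - - x) =
    (-1) ^+ count P s * \prod_(x <- s | P x) (k - x).
  rewrite -sum1_count -prodrXr -big_split /=; apply: eq_bigr => x _.
  by rewrite expr1 mulN1r opprB opprK addrC.
rewrite !prN mulrACA -exprD count_predT.
have := count_predC (pred1 k) ls; rewrite (count_uniq_mem _ uls) kls szls add1n.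
by move=> [<-]; rewrite addnn -mul2n exprM sqrrN !expr1n mul1r.
Qed.

End Interlacing.

(** * Diagonals and squared moduli of isospectral arrow matrices *)

Section Residues.
Variable R : realFieldType.

Lemma poly_ext (p q : {poly R}) : (forall z, p.[z] = q.[z]) -> p = q.
Proof.
move=> pq; apply/eqP; rewrite -subr_eq0; apply/negPn/negP => d0.
pose rs := [seq i%:R : R | i <- iota 0 (size (p - q))].
have := max_poly_roots (rs := rs) d0; rewrite size_map size_iota ltnn.
move=> H; suff: false by []. apply: H.
  by apply/allP => z _; rewrite rootE hornerD hornerN pq subrr.
by rewrite map_inj_uniq ?iota_uniq// => i j /eqP; rewrite eqr_nat => /eqP.
Qed.

(** The partial fraction of prod (X - l_k) / (X - y_k) has nonnegative residues
    when l_0 <= y_0 <= l_1 <= y_1 <= ...  One factor is added at a time: either it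
    cancels, or [y m] exceeds all previous [y p] and the new residues can be
    written down. *)
Lemma exists_residues (y l : nat -> R) m :
  (forall p q, (p < q < m)%N -> y p <= l q) -> (forall p, (p < m)%N -> l p <= y p) ->
  exists2 e : nat -> R, (forall p, (p < m)%N -> 0 <= e p) &
    \prod_(k < m) ('X - (l k)%:P) = \prod_(k < m) ('X - (y k)%:P) +
    \sum_(p < m) (e p)%:P * \prod_(k < m | k != p) ('X - (y k)%:P).
Proof.
elim: m => [|m IHm] yl ly; first by exists (fun=> 0) => //; rewrite !big_ord0 addr0.
have [||e e_ge0 eE] := IHm.
- by move=> p q /andP[pq qm]; apply: yl; rewrite pq ltnS ltnW.
- by move=> p pm; apply: ly; exact: ltnW.
have prod_old (p : 'I_m) : \prod_(k < m.+1 | k != widen_ord (leqnSn m) p) ('X - (y k)%:P) =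
    \prod_(k < m | k != p) ('X - (y k)%:P) * ('X - (y m)%:P).
  rewrite big_mkcond big_ord_recr /= -big_mkcond /=.
  by rewrite (_ : ord_max != _)// -val_eqE /= gtn_eqF.
have prod_new : \prod_(k < m.+1 | k != ord_max) ('X - (y k)%:P) =
    \prod_(k < m) ('X - (y k)%:P).
  rewrite big_mkcond big_ord_recr /= eqxx mulr1; apply: eq_bigr => k _.
  by rewrite (_ : _ != _)// -val_eqE /= ltn_eqF.
(* The new factor cancels iff [y m = l m]. *)
have := ly m (leqnn _); rewrite le_eqVlt => /orP[/eqP ly_m|ly_m].
  exists (fun p => if p == m then 0 else e p) => [p|].
    by case: eqP => // pm; rewrite ltnS leq_eqVlt => /orP[/eqP//|/e_ge0].
  rewrite !big_ord_recr /= eqxx mul0r addr0 eE ly_m mulrDl; congr (_ + _).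
  rewrite mulr_suml; apply: eq_bigr => p _; rewrite prod_old mulrA.
  by rewrite ltn_eqF.
have yy (p : 'I_m) : y m - y p != 0.
  by rewrite subr_eq0 gt_eqF// (le_lt_trans _ ly_m)// yl// ltn_ord ltnSn.
exists (fun p => if p == m then (y m - l m) * (1 + \sum_(p < m) e p / (y m - y p))
                 else e p * (l m - y p) / (y m - y p)) => [p|].
  case: eqP => [->|/eqP pm] pm1.
    apply: mulr_ge0; first by rewrite subr_ge0 ltW.
    apply: addr_ge0 => //; apply: sumr_ge0 => q _.
    by apply: divr_ge0; [exact: e_ge0|rewrite subr_ge0 ltW// (le_lt_trans _ ly_m)// yl// ltn_ord ltnSn].
  have pm' : (p < m)%N by rewrite ltn_neqAle pm.
  have ylm : y p <= l m by apply: yl; rewrite pm' ltnSn.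
  rewrite divr_ge0// ?mulr_ge0// ?e_ge0// subr_ge0//.
  exact: le_trans ylm (ltW _).
set Q := \prod_(k < m) ('X - (y k)%:P) in eE prod_new.
rewrite !big_ord_recr /= eqxx -/Q prod_new eE.
set V := (y m - l m) * _.
(* (X - l_m) / ((X - y_p) (y_m - y_p)) is split into its poles at [y p], [y m]. *)
have -> : \sum_(i < m) (if (i : nat) == m then V else e i * (l m - y i) / (y m - y i))%:P *
      \prod_(k < m.+1 | k != widen_ord (leqnSn m) i) ('X - (y k)%:P) =
    \sum_(p < m) ((e p)%:P * \prod_(k < m | k != p) ('X - (y k)%:P) * ('X - (l m)%:P)
                 - (e p * (y m - l m) / (y m - y p))%:P * Q).
  apply: eq_bigr => p _; rewrite prod_old ltn_eqF//.
  have -> : Q = ('X - (y p)%:P) * \prod_(k < m | k != p) ('X - (y k)%:P).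
    by rewrite /Q (bigD1 p).
  have := yy p; set d := y m - y p => d0.
  have ymE : y m = y p + d by rewrite /d addrC subrK.
  have -> : e p = (e p / d) * d by rewrite divfK.
  set u := e p / d; rewrite ymE.
  have -> : u * d * (l m - y p) / d = u * (l m - y p) by field.
  have -> : u * d * (y p + d - l m) / d = u * (y p + d - l m) by field.
  rewrite !(polyCM, polyCB, polyCD); ring.
have -> : V = (y m - l m) + \sum_(p < m) e p * (y m - l m) / (y m - y p).
  rewrite /V mulrDr mulr1 mulr_sumr; congr (_ + _).
  by apply: eq_bigr => p _; rewrite mulrA [_ * e _]mulrC.
rewrite sumrB -!mulr_suml -raddf_sum polyCD polyCB /=; ring.
Qed.

End Residues.

Section Model.
Variables (R : realFieldType) (n : nat) (lam : 'I_n.+1 -> R).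
Hypothesis lam_incr : forall i j : 'I_n.+1, (i < j)%N -> lam i < lam j.
Implicit Types a c : 'I_n -> R.

(** [lo p] and [hi p] are the ends of the interval I_(p+1). *)
Definition lo (p : 'I_n) : R := lam (widen_ord (leqnSn n) p).
Definition hi (p : 'I_n) : R := lam (lift ord0 p).

Definition is_model a c : Prop :=
  (forall i, 0 <= c i) /\ arrow_poly (corner lam a) a c = spectral_poly lam.

Definition in_box (s : 'S_n) a : Prop := forall i, lo (s i) <= a i <= hi (s i).

Lemma lam_inj : injective lam.
Proof.
move=> i j ij; apply: val_inj; case: (ltngtP i j) => // /lam_incr; by rewrite ij ltxx.
Qed.

Lemma lam_le (i j : 'I_n.+1) : (i <= j)%N -> lam i <= lam j.
Proof.
by rewrite leq_eqVlt => /orP[/eqP/val_inj->//|/lam_incr/ltW].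
Qed.

Lemma lt_lam (i j : 'I_n.+1) : (lam i < lam j) = (i < j)%N.
Proof.
apply/idP/idP => [|/lam_incr//]; rewrite ltnNge; apply: contraTN => /lam_le.
by rewrite leNgt.
Qed.

Lemma spectral_cofactor_neq0 j : spectral_cofactor lam j (lam j) != 0.
Proof.
apply/prodf_neq0 => m mj; rewrite subr_eq0; apply: contraNneq mj => /lam_inj->//.
Qed.

(** With q = prod_i (X - a_i) and P the characteristic polynomial, P / q has
    derivative 1 + sum_i c_i / (X - a_i)^2 > 0, so that P' q >= 0 at the zeros
    of P. *)
Lemma model_sign a c j : is_model a c ->
  0 <= \prod_i (lam j - a i) * spectral_cofactor lam j (lam j).
Proof.
move=> [c_ge0 mE]; set l := lam j.
have [[i ai]|nai] := pselect (exists i, a i = l).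
  by rewrite (bigD1 i)//= ai subrr !mul0r.
have lai i : l - a i != 0.
  by rewrite subr_eq0; apply/eqP => lai; apply: nai; exists i.
rewrite -horner_diag_poly -deriv_spectral_poly -mE.
set q := (diag_poly a).[l]; set q' := (diag_poly a)^`().[l].
have qiE i : (codiag_poly a i).[l] = q / (l - a i).
  by rewrite /q (diag_polyE a i) !hornerE mulrAC mulfV// mul1r.
have q'iE i : (codiag_poly a i)^`().[l] = (q' - q / (l - a i)) / (l - a i).
  rewrite /q' {1}(diag_polyE a i) derivM derivXsubC mul1r !hornerE -qiE.
  move: (codiag_poly a i).[l] (codiag_poly a i)^`().[l] => A B.
  move: (l - a i) (lai i) => d d0.
  by rewrite [A + _]addrC addrK mulrAC mulfV// mul1r.
have E0 : (l - corner lam a) * q = \sum_i c i * (q / (l - a i)).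
  have : (arrow_poly (corner lam a) a c).[l] = 0.
    by rewrite mE (spectral_cofactorE lam j) subrr mul0r.
  rewrite /arrow_poly !hornerE horner_sum => /eqP; rewrite subr_eq0 => /eqP->.
  by apply: eq_bigr => i _; rewrite hornerM hornerC qiE.
rewrite /arrow_poly derivB derivM derivXsubC mul1r !hornerE raddf_sum horner_sum.
under eq_bigr do rewrite /= deriv_mulC hornerM hornerC q'iE.
rewrite -/q -/q'.
have -> : q * (q + (l - corner lam a) * q' - \sum_(i < n) c i * ((q' - q / (l - a i)) / (l - a i)))
   = q ^+ 2 + \sum_i c i * (q / (l - a i)) ^+ 2.
  rewrite mulrBr mulrDr -expr2 -addrA; congr (_ + _).
  rewrite mulrA [q * _]mulrC E0 mulr_suml mulr_sumr -sumrB; apply: eq_bigr => i _.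
  by field; exact: lai.
apply: addr_ge0; first exact: sqr_ge0.
by apply: sumr_ge0 => i _; apply: mulr_ge0 => //; exact: sqr_ge0.
Qed.

(** Cauchy interlacing: the sorted diagonal entries lie in the successive
    intervals. *)
Lemma model_in_box a c : is_model a c -> exists s, in_box s a.
Proof.
move=> mod.
pose lt i k := (a i < a k) || ((a i == a k) && (i < k)%N).
have [s sP] : exists s : 'S_n, forall i k, (s i < s k)%N = lt i k.
  apply: rank_perm; rewrite /lt.
  - by move=> i; rewrite ltxx ltnn andbF.
  - move=> k i m /orP[ik|/andP[/eqP-> ik]] /orP[km|/andP[/eqP<- km]].
    + by rewrite (lt_trans ik km).
    + by rewrite ik.
    + by rewrite km.
    + by rewrite eqxx (ltn_trans ik km) orbT.
  - move=> i k ik; case: ltgtP => //= _.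
    by move: ik; rewrite neq_ltn => /orP[] ->; rewrite ?orbT.
pose ls := [seq lam k | k <- enum 'I_n.+1].
pose xs := [seq a i | i <- enum 'I_n].
have uls : uniq ls by rewrite map_inj_uniq ?enum_uniq//; exact: lam_inj.
have szls : size ls = (size xs).+1 by rewrite /ls /xs !size_map -!enumT !size_enum_ord.
have sgn l : l \in ls ->
    0 <= \prod_(x <- xs) (l - x) * \prod_(m <- ls | m != l) (l - m).
  move=> /mapP[j _ ->]; have := model_sign j mod.
  rewrite !big_map -!enumT big_enum big_enum_cond /spectral_cofactor /=.
  have -> : \prod_(m | lam m != lam j) (lam j - lam m) = \prod_(m | m != j) (lam j - lam m).
    by apply: eq_bigl => m; rewrite (inj_eq lam_inj).
  by [].
have cls (P : pred R) : count P ls = #|[pred j | P (lam j)]|.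
  by rewrite count_map cardE /enum_mem size_filter count_filter; apply: eq_count => x; rewrite !inE /= andbT.
have cxs (P : pred R) : count P xs = #|[pred i | P (a i)]|.
  by rewrite count_map cardE /enum_mem size_filter count_filter; apply: eq_count => x; rewrite !inE /= andbT.
have le_a k i : (s k <= s i)%N -> a k <= a i.
  rewrite leq_eqVlt sP /lt => /orP[/eqP/val_inj/perm_inj->//|].
  by case/orP => [/ltW//|/andP[/eqP->]].
exists s => i; apply/andP; split; rewrite leNgt; apply/negP => ai.
  have lls : lo (s i) \in ls by apply: map_f; rewrite mem_enum.
  have := count_lt_le uls szls sgn lls; rewrite cls cxs; apply/negP; rewrite -ltnNge.
  rewrite (eq_card (B := [pred j : 'I_n.+1 | (j < s i)%N])) => [|j]; last first.
    by rewrite !inE lt_lam.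
  rewrite card_ord_lt; last by rewrite ltnW// ltnS ltnW.
  rewrite -[X in (X <= _)%N](card_perm_lt s (ltn_ord (s i))).
  apply/subset_leq_card/fintype.subsetP => k; rewrite !inE ltnS => /le_a.
  by move=> /le_lt_trans; exact.
have lls : hi (s i) \in ls by apply: map_f; rewrite mem_enum.
have := count_gt_le uls szls sgn lls; rewrite cls cxs; apply/negP; rewrite -ltnNge.
have := cardC [pred j : 'I_n.+1 | (j < (s i).+2)%N].
rewrite card_ord_lt; last by rewrite ltnS ltn_ord.
have := cardC [pred k : 'I_n | (s k < s i)%N].
rewrite card_perm_lt; last exact/ltnW.
rewrite (@eq_card _ [predC [pred j : 'I_n.+1 | (j < (s i).+2)%N]]
  [pred j | hi (s i) < lam j]) => [|j]; last first.
  by rewrite !inE lt_lam -ltnNge.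
have : (#|[predC [pred k : 'I_n | (s k < s i)%N]]| <= #|[pred k | (hi (s i) < a k)%R]|)%N.
  apply/subset_leq_card/fintype.subsetP => k; rewrite !inE -leqNgt => /le_a.
  exact: lt_le_trans.
rewrite !card_ord => H1 H2 H3.
rewrite -(ltn_add2l (s i).+2) H3 !addSn !ltnS -[X in (X <= _)%N]H2.
by rewrite leq_add2l.
Qed.

(** Multiplying the partial fraction of [exists_residues] by the remaining factor
    X - lam_n turns the residues e_p into weights e_p (lam_n - y_p). *)
Lemma box_model s a : in_box s a -> exists c, is_model a c.
Proof.
move=> sa.
pose y p := if insub p is Some i then a ((s^-1)%g i) else 0.
have yE (i : 'I_n) : y i = a ((s^-1)%g i) by rewrite /y valK.
pose l p := lam (inord p).
have lE (j : 'I_n.+1) : l j = lam j by rewrite /l inord_val.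
have loE p (pn : (p < n)%N) : l p = lo (Ordinal pn).
  by rewrite /lo -lE.
have hiE p (pn : (p < n)%N) : l p.+1 = hi (Ordinal pn).
  by rewrite /hi -lE.
have yb p (pn : (p < n)%N) : lo (Ordinal pn) <= y p <= hi (Ordinal pn).
  by rewrite -[p]/(val (Ordinal pn)) yE; have := sa ((s^-1)%g (Ordinal pn)); rewrite permKV.
have [||e e_ge0 eE] := @exists_residues R y l n.
- move=> p q /andP[pq qn]; have pn := ltn_trans pq qn.
  have /andP[_ /le_trans->//] := yb _ pn; rewrite -hiE.
  by rewrite /l lam_le// !inordK// ltnS ltnW.
- by move=> p pn; have /andP[] := yb _ pn; rewrite loE.
pose L := lam ord_max.
have aL i : a i <= L.
  by have /andP[_ /le_trans->//] := sa i; rewrite lam_le//= -ltnS ltn_ord.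
exists (fun i => e (s i) * (L - a i)).
have [c_ge0 mE] : (forall i, 0 <= e (s i) * (L - a i)) /\
    arrow_poly (L - \sum_(p < n) e p) a (fun i => e (s i) * (L - a i)) = spectral_poly lam.
  split=> [i|]; first by rewrite mulr_ge0 ?subr_ge0// e_ge0.
  have DE : \prod_(k < n) ('X - (y k)%:P) = diag_poly a.
    rewrite /diag_poly [RHS](reindex_inj (@perm_inj _ (s^-1)%g)) /=.
    by apply: eq_bigr => i _; rewrite yE.
  have CE i : \prod_(k < n | k != s i) ('X - (y k)%:P) = codiag_poly a i.
    rewrite /codiag_poly [RHS](reindex_inj (@perm_inj _ (s^-1)%g)) /=.
    apply: eq_big => [k|k _]; last by rewrite yE.
    by congr (~~ _); rewrite -[RHS](inj_eq (@perm_inj _ s)) permKV.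
  have -> : spectral_poly lam = \prod_(k < n) ('X - (l k)%:P) * ('X - L%:P).
    rewrite /spectral_poly big_ord_recr /=; congr (_ * _).
    by apply: eq_bigr => p _; rewrite -lE.
  rewrite eE DE [in RHS](reindex_inj (@perm_inj _ s)) /=.
  rewrite [in RHS]mulrDl mulr_suml.
  have -> : \sum_(i < n) (e (s i))%:P * \prod_(k < n | k != s i) ('X - (y k)%:P) * ('X - L%:P) =
     \sum_(i < n) ((e (s i))%:P * diag_poly a - (e (s i) * (L - a i))%:P * codiag_poly a i).
    apply: eq_bigr => i _; rewrite CE (diag_polyE a i) polyCM polyCB; ring.
  have -> : \sum_(p < n) e p = \sum_i e (s i) by exact: reindex_inj (@perm_inj _ s).
  by rewrite sumrB -mulr_suml -raddf_sum /= /arrow_poly polyCB; ring.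
by split=> //; rewrite -(corner_unique mE).
Qed.

Lemma in_box_convex s (a a' : 'I_n -> R) (t : R) : in_box s a -> in_box s a' ->
  0 <= t -> t <= 1 -> in_box s (fun i => t * a i + (1 - t) * a' i).
Proof.
move=> sa sa' t0 t1 i; have /andP[? ?] := sa i; have /andP[? ?] := sa' i.
by apply/andP; split; nra.
Qed.

End Model.

(** * Pushing close diagonal entries apart *)

Section Deformation.
Variables (R : realFieldType) (n : nat) (lam : 'I_n.+1 -> R) (om : R).
Hypothesis lam_incr : forall i j : 'I_n.+1, (i < j)%N -> lam i < lam j.
Hypothesis om_gt0 : 0 < om.
Hypothesis om_gap : forall i j : 'I_n.+1, (i < j)%N -> om <= lam j - lam i.
Implicit Types (a c : 'I_n -> R) (t : R) (s : 'S_n).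

Local Notation lo := (lo lam).
Local Notation hi := (hi lam).
Local Notation in_box := (in_box lam).
Local Notation is_model := (is_model lam).

Lemma hi_lo (p q : 'I_n) : (p < q)%N -> hi p <= lo q.
Proof. by move=> pq; apply: lam_le. Qed.

Lemma box_le s a i k : in_box s a -> (s i < s k)%N -> a i <= a k.
Proof.
move=> sa /hi_lo ik; have /andP[_ ai] := sa i; have /andP[ak _] := sa k.
exact: le_trans ai (le_trans ik ak).
Qed.

Lemma om_lo_hi p : lo p + om <= hi p.
Proof. by rewrite addrC -lerBrDr; apply: om_gap. Qed.

Lemma box_far s a i k : in_box s a -> ((s i).+1 < s k)%N -> om <= a k - a i.
Proof.
move=> sa ik; have /andP[_ ai] := sa i; have /andP[ak _] := sa k.
have : om <= lo (s k) - hi (s i) by apply: om_gap.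
lra.
Qed.

(** Two of three indices have positions that differ by at least 2, and a whole
    interval lies between their boxes. *)
Lemma box_three s a i k l : in_box s a -> i != k -> k != l -> i != l ->
  [\/ om <= `|a i - a k|, om <= `|a k - a l| | om <= `|a i - a l|].
Proof.
move=> sa ik kl il.
have sik : s i != s k by rewrite (inj_eq perm_inj).
have skl : s k != s l by rewrite (inj_eq perm_inj).
have sil : s i != s l by rewrite (inj_eq perm_inj).
have far x y : ((s x).+1 < s y)%N -> om <= `|a x - a y|.
  move=> /(box_far sa) /le_trans; apply.
  by rewrite distrC ler_norm.
have far' x y : ((s y).+1 < s x)%N -> om <= `|a x - a y|.
  by move=> /far; rewrite distrC.
have [?|h1] := ltnP (s i).+1 (s k); first by constructor 1; exact: far.
have [?|h2] := ltnP (s k).+1 (s i); first by constructor 1; exact: far'.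
have [?|h3] := ltnP (s k).+1 (s l); first by constructor 2; exact: far.
have [?|h4] := ltnP (s l).+1 (s k); first by constructor 2; exact: far'.
have [?|h5] := ltnP (s i).+1 (s l); first by constructor 3; exact: far.
have [?|h6] := ltnP (s l).+1 (s i); first by constructor 3; exact: far'.
move: sik skl sil; rewrite -!val_eqE /=; lia.
Qed.

Lemma box_pair s a i k : in_box s a -> i != k -> a i = a k ->
  exists j, a i = lam j.
Proof.
move=> sa ik aik; have : s i != s k by rewrite (inj_eq perm_inj).
have /andP[li hi_i] := sa i; have /andP[lk hk] := sa k.
rewrite neq_ltn => /orP[/hi_lo|/hi_lo] h.
  exists (lift ord0 (s i)); apply/eqP; rewrite eq_le hi_i /= aik.
  exact: le_trans h lk.
exists (lift ord0 (s k)); apply/eqP; rewrite eq_le {1}aik hk /=.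
exact: le_trans h li.
Qed.

Lemma box_no_triple s a i k l : in_box s a -> i != k -> k != l -> i != l ->
  a i = a k -> a l != a i.
Proof.
move=> sa ik kl il aik; apply/eqP => ali.
by case: (box_three sa ik kl il); rewrite ?ali -?aik ?subrr ?normr0 leNgt om_gt0.
Qed.

(** A cut-off around lam_j.  Its radius is a third of the bound [om] on the gaps: a
    pushed entry moves by less than a radius, and so cannot reach another lam_m. *)
Definition tent j (z : R) : R := Num.max 0 (1 - `|z - lam j| / (om / 3)).

Definition closeness j a i k : R := tent j (a i) * tent j (a k).

(** Only one summand can be nonzero ([closeness_unique]); the sum makes the formula
    symmetric in the indices and continuous. *)
Definition shift a i : R := \sum_(k | k != i) \sum_j closeness j a i k * (a k - lam j).

Definition push t a i : R := a i - t * shift a i.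

Lemma tent_ge0 j z : 0 <= tent j z.
Proof. by rewrite le_max lexx. Qed.

Lemma tent_le1 j z : tent j z <= 1.
Proof.
rewrite ge_max ler01 gerBl; apply: divr_ge0 => //; apply: divr_ge0 => //.
exact: ltW.
Qed.

Lemma tent_lam j : tent j (lam j) = 1.
Proof. by rewrite /tent subrr normr0 mul0r subr0; apply/max_idPr. Qed.

Lemma tent_near j z : tent j z != 0 -> `|z - lam j| < om / 3.
Proof.
apply: contraNT; rewrite -leNgt => h; apply/eqP/max_idPl.
by rewrite subr_le0 ler_pdivlMr ?mul1r// divr_gt0.
Qed.

Lemma closenessC j a i k : closeness j a i k = closeness j a k i.
Proof. exact: mulrC. Qed.

Lemma closeness_ge0 j a i k : 0 <= closeness j a i k.
Proof. by apply: mulr_ge0; exact: tent_ge0. Qed.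

Lemma closeness_le1 j a i k : closeness j a i k <= 1.
Proof. by apply: mulr_ile1; rewrite ?tent_ge0 ?tent_le1. Qed.

Lemma closeness_near j a i k : closeness j a i k != 0 ->
  `|a i - lam j| < om / 3 /\ `|a k - lam j| < om / 3.
Proof. by rewrite mulf_eq0 negb_or => /andP[/tent_near ? /tent_near]. Qed.

Lemma lam_close j j' : `|lam j - lam j'| < om -> j = j'.
Proof.
move=> h; apply: val_inj; case: (ltngtP j j') => // /om_gap.
  by rewrite distrC in h; move=> /le_lt_trans-/(_ _ (le_lt_trans (ler_norm _) h)); rewrite ltxx.
by move=> /le_lt_trans-/(_ _ (le_lt_trans (ler_norm _) h)); rewrite ltxx.
Qed.

Lemma near_unique j j' z : `|z - lam j| < om / 3 -> `|z - lam j'| < om / 3 -> j = j'.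
Proof.
move=> h h'; apply: lam_close; have := om_gt0; move: h h'.
rewrite !ltr_norml => /andP[? ?] /andP[? ?] ?; apply/andP; split; lra.
Qed.

Lemma closeness_unique s a i k k' j j' : in_box s a -> k != i -> k' != i ->
  closeness j a i k != 0 -> closeness j' a i k' != 0 -> j' = j /\ k' = k.
Proof.
move=> sa ki k'i /closeness_near[ij kj] /closeness_near[ij' k'j'].
have jj := near_unique ij' ij; split=> //; subst j'.
apply/eqP/negPn/negP => kk'; have := om_gt0.
rewrite eq_sym in kk'; rewrite eq_sym in k'i.
have h := box_three sa ki k'i kk'; move=> o.
move: ij kj k'j' h; rewrite !ltr_norml => /andP[? ?] /andP[? ?] /andP[? ?].
by case; rewrite leNgt ltr_norml => /negP; apply; apply/andP; split; lra.
Qed.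

Lemma shift_near s a i k j : in_box s a -> k != i -> closeness j a i k != 0 ->
  shift a i = closeness j a i k * (a k - lam j).
Proof.
move=> sa ki kij; rewrite /shift (bigD1 k)//= [X in _ + X]big1 ?addr0; last first.
  move=> k' /andP[k'i k'k]; apply: big1 => j' _.
  have [->|/(closeness_unique sa ki k'i kij)[_ kk']] := eqVneq (closeness j' a i k') 0.
    by rewrite mul0r.
  by rewrite kk' eqxx in k'k.
rewrite (bigD1 j)//= big1 ?addr0// => j' j'j.
have [->|/(closeness_unique sa ki ki kij)[jj _]] := eqVneq (closeness j' a i k) 0.
  by rewrite mul0r.
by rewrite jj eqxx in j'j.
Qed.

Lemma shift_cases s a i : in_box s a ->
  shift a i = 0 \/ exists k j, [/\ k != i, closeness j a i k != 0 &
    shift a i = closeness j a i k * (a k - lam j)].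
Proof.
move=> sa.
have [[k [j [ki kij]]]|no] := pselect (exists k j, k != i /\ closeness j a i k != 0).
  by right; exists k, j; split=> //; exact: shift_near sa ki kij.
left; apply: big1 => k ki; apply: big1 => j _.
have [->|kij] := eqVneq (closeness j a i k) 0; first by rewrite mul0r.
by case: no; exists k, j.
Qed.

(** An entry can only move away from the crossing that it is close to, and it
    stays away from the other end of its interval. *)
Lemma push_cases s a t i : in_box s a -> 0 <= t -> t <= 1 ->
  [\/ push t a i = a i, push t a i <= a i /\ lo (s i) < push t a i |
      a i <= push t a i /\ push t a i < hi (s i)].
Proof.
move=> sa t0 t1; rewrite /push.
have [->|[k [j [ki kij ->]]]] := shift_cases i sa.
  by constructor 1; rewrite mulr0 subr0.
have [ai ak] := closeness_near kij.
have k0 := closeness_ge0 j a i k; have k1 := closeness_le1 j a i k.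
set u := closeness j a i k in k0 k1 *.
have tu0 : 0 <= t * u by exact: mulr_ge0.
have tu1 : t * u <= 1 by exact: mulr_ile1.
rewrite mulrA; move: (t * u) tu0 tu1 => w w0 w1.
have /andP[li hi_i] := sa i; have /andP[lk hk] := sa k.
have o := om_gt0.
move: ai ak; rewrite !ltr_norml => /andP[a1 a2] /andP[a3 a4].
have : s i != s k by rewrite (inj_eq perm_inj) eq_sym.
rewrite neq_ltn => /orP[/hi_lo|/hi_lo] h.
- have E : lift ord0 (s i) = j.
    apply: lam_close; rewrite -/(hi _) ltr_norml; apply/andP; split; lra.
  have E' : widen_ord (leqnSn n) (s k) = j.
    apply: lam_close; rewrite -/(lo _) ltr_norml; apply/andP; split; lra.
  have hE : hi (s i) = lam j by rewrite /hi E.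
  have lE : lo (s k) = lam j by rewrite /lo E'.
  constructor 2; have := om_lo_hi (s i); rewrite hE => ?; split; first by nra.
  have : w * (a k - lam j) <= om / 3 by nra.
  lra.
- have E : widen_ord (leqnSn n) (s i) = j.
    apply: lam_close; rewrite -/(lo _) ltr_norml; apply/andP; split; lra.
  have E' : lift ord0 (s k) = j.
    apply: lam_close; rewrite -/(hi _) ltr_norml; apply/andP; split; lra.
  have lE : lo (s i) = lam j by rewrite /lo E.
  have hE : hi (s k) = lam j by rewrite /hi E'.
  constructor 3; have := om_lo_hi (s i); rewrite lE => ?; split; first by nra.
  have : w * (lam j - a k) <= om / 3 by nra.
  lra.
Qed.

Lemma push_box s a t : in_box s a -> 0 <= t -> t <= 1 -> in_box s (push t a).
Proof.
move=> sa t0 t1 i; have /andP[li hi_i] := sa i.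
case: (push_cases i sa t0 t1) => [->|[h1 h2]|[h1 h2]]; first by rewrite li.
  by rewrite (ltW h2) (le_trans h1).
by rewrite (ltW h2) (le_trans li).
Qed.

Lemma push_pair s a t i k : in_box s a -> i != k -> a i = a k -> push t a i = a i.
Proof.
move=> sa ik aik; have [j aj] := box_pair sa ik aik.
rewrite /push (@shift_near s a i k j sa); last 2 first.
- by rewrite eq_sym.
- by rewrite /closeness -aik aj tent_lam mulr1 oner_eq0.
by rewrite -aik aj subrr !mulr0 subr0.
Qed.

(** Entries that become equal meet at a common end of two intervals, and by
    [push_cases] an entry that is at an end after pushing was there before. *)
Lemma push_inj s a t i k : in_box s a -> 0 <= t -> t <= 1 -> i != k ->
  push t a i = push t a k -> a i = a k.
Proof.
move=> sa t0 t1; wlog ik : i k / (s i < s k)%N => [wl ik|_].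
  have : s i != s k by rewrite (inj_eq perm_inj).
  rewrite neq_ltn => /orP[h|h]; first exact: wl.
  by move=> h'; apply/esym/wl; rewrite // eq_sym.
have sp := push_box sa t0 t1.
have /andP[li hi_i] := sa i; have /andP[lk hk] := sa k.
have /andP[_ h1] := sp i; have /andP[h2 _] := sp k.
have h := hi_lo ik => e.
case: (push_cases i sa t0 t1) => [e1|[e1 _]|[_ e1]];
case: (push_cases k sa t0 t1) => [e2|[_ e2]|[e2 _]]; lra.
Qed.

Local Notation cof := (spectral_cofactor lam).

(** For an entry [a i] close to lam_j with partner [a k] one has c_i = tau g_i and
    c_k = (1 - tau) g_k with tau : 1 - tau = u : v, where g_i is the product of the
    factors that stay positive at the crossing, up to a common sign the quotient
    [spectral_cofactor lam j (a i) / gaps2 a i k].  The defect vanishes iff the new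
    ratio tau' satisfies (1 + t kappa) tau' = tau + t kappa (1 - tau), kappa being
    the closeness; denominators are cleared so that it makes sense everywhere. *)
Definition weight_defect t a a' c c' i k j : R :=
  c' i * gaps2 a' i k * (1 + t * closeness j a i k) * cof j (a k) * cof j (a i) -
  cof j (a' i) * (c i * gaps2 a i k * cof j (a k) +
                  t * closeness j a i k * c k * gaps2 a k i * cof j (a i)).

Definition weight_rel t a a' c c' : Prop :=
  forall i k j, i != k -> closeness j a i k * weight_defect t a a' c c' i k j = 0.

Lemma model_gaps a c i : is_model a c ->
  c i * gaps a i = - (spectral_poly lam).[a i].
Proof. by move=> [_ <-]; rewrite arrow_poly_at mulNr opprK. Qed.

Lemma model_gaps2 a c i k : is_model a c -> i != k -> a i = a k ->
  (c i + c k) * gaps2 a i k = - (spectral_poly lam)^`().[a i].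
Proof. by move=> [_ <-] ik aik; rewrite (arrow_poly_deriv_at _ _ ik aik) mulNr opprK. Qed.

Lemma pair_sum_neq0 s a c i k : in_box s a -> is_model a c -> i != k -> a i = a k ->
  c i + c k != 0.
Proof.
move=> sa mod ik aik; have [j aj] := box_pair sa ik aik.
apply/eqP => cc; have := model_gaps2 mod ik aik.
rewrite cc mul0r aj deriv_spectral_poly => /esym/eqP; rewrite oppr_eq0.
by apply/negP; exact: spectral_cofactor_neq0.
Qed.

Lemma gaps2_pairC a i k : a i = a k -> gaps2 a k i = gaps2 a i k.
Proof.
by move=> aik; apply: eq_big => [l|l _]; [rewrite andbC|rewrite aik].
Qed.

Lemma gaps2_neq0 s a i k : in_box s a -> i != k -> a i = a k -> gaps2 a i k != 0.
Proof.
move=> sa ik aik; apply/prodf_neq0 => l /andP[li lk].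
rewrite subr_eq0 eq_sym; apply: (box_no_triple sa ik) => //; first by rewrite eq_sym.
by rewrite eq_sym.
Qed.

(** At a double entry the closeness is 1 and the equation can be solved for
    [c' i]. *)
Lemma weights_double s t a c c' i k : in_box s a -> 0 <= t -> weight_rel t a (push t a) c c' ->
  i != k -> a i = a k ->
  c' i * gaps2 (push t a) i k * (1 + t) = (c i + t * c k) * gaps2 a i k.
Proof.
move=> sa t0 r ik aik; have [j aj] := box_pair sa ik aik.
have pi : push t a i = lam j by rewrite (push_pair t sa ik aik).
have := r i k j ik; rewrite /weight_defect /closeness pi -aik aj tent_lam !mulr1 mul1r.
rewrite (gaps2_pairC aik); have := spectral_cofactor_neq0 lam_incr j.
set P := cof j (lam j) => P0 h.
apply: (mulIf P0); apply: (mulIf P0); apply/eqP; rewrite -subr_eq0 -[X in _ == X]h.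
by apply/eqP; ring.
Qed.

(** A weight at a simple diagonal entry is, up to sign, the value of the spectral
    polynomial there divided by the gaps; at a double entry it is given by the
    relation.  The last hypothesis holds for equal [c] and [d], but also for
    [t = 1], when both sides depend on [a] only. *)
Lemma weights_unique s t a c d c' d' : in_box s a -> 0 <= t -> t <= 1 ->
  is_model (push t a) c' -> is_model (push t a) d' ->
  weight_rel t a (push t a) c c' -> weight_rel t a (push t a) d d' ->
  (forall i k, i != k -> a i = a k -> (c i + t * c k) * gaps2 a i k =
                                      (d i + t * d k) * gaps2 a i k) ->
  c' =1 d'.
Proof.
move=> sa t0 t1 mc md rc rd cd i; have sp := push_box sa t0 t1.
have [[k [ki pik]]|no] := pselect (exists k, k != i /\ push t a k = push t a i).
  have ik : i != k by rewrite eq_sym.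
  have aik := push_inj sa t0 t1 ik (esym pik).
  have := weights_double sa t0 rc ik aik; rewrite (cd _ _ ik aik).
  rewrite -(weights_double sa t0 rd ik aik).
  have t10 : 1 + t != 0 by rewrite gt_eqF//; lra.
  by move=> /(mulIf t10)/(mulIf (gaps2_neq0 sp ik (esym pik))).
have g0 : gaps (push t a) i != 0.
  by apply: gaps_simple => k ki; apply/eqP => pki; apply: no; exists k.
by apply: (mulIf g0); rewrite (model_gaps i mc) (model_gaps i md).
Qed.

(** The terms of an involution's orbits cancel in pairs. *)
Lemma codiag_sum0 a (e : 'I_n -> R) (p : 'I_n -> 'I_n) : involutive p ->
  (forall i, a (p i) = a i) -> (forall i, e (p i) = - e i) ->
  \sum_i (e i)%:P * codiag_poly a i = 0.
Proof.
move=> pK ap ep; set S := \sum_i _.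
have : S = - S.
  rewrite {1}/S (reindex_inj (inv_inj pK)) /= /S -sumrN; apply: eq_bigr => i _.
  by rewrite ep (codiag_poly_eq (ap i)) polyCN mulNr.
move/eqP; rewrite -addr_eq0 => /eqP S0.
have : (2%:P : {poly R}) * S = 0 by rewrite -[2]/(1 + 1) polyCD mulrDl mul1r.
by move/eqP; rewrite mulf_eq0 polyC_eq0 pnatr_eq0 /= => /eqP.
Qed.

(** Weights [c0] on the pushed diagonal exist by [box_model].  They may be
    redistributed between two equal entries as long as the sum is kept, which
    is done in the proportion demanded by the relation; at simple entries the
    relation is then an identity. *)
Lemma weights_exist s t a c : in_box s a -> 0 <= t -> t <= 1 -> is_model a c ->
  exists2 c', is_model (push t a) c' & weight_rel t a (push t a) c c'.
Proof.
move=> sa t0 t1 mod; have sp := push_box sa t0 t1.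
have [c0 mod0] := box_model lam_incr sp.
have t10 : 1 + t != 0 by rewrite gt_eqF//; lra.
(* [mate i] is the other index with the same entry, or [i] itself. *)
pose mate i := odflt i [pick k | (k != i) && (a k == a i)].
have mateP i k : k != i -> a k = a i -> mate i = k.
  move=> ki aki; rewrite /mate; case: pickP => [l /andP[li /eqP ali]|/(_ k)]; last first.
    by rewrite ki aki eqxx.
  apply/eqP/negPn/negP => lk.
  rewrite eq_sym in ki; rewrite eq_sym in li; rewrite /= eq_sym in lk.
  by have := box_no_triple sa ki lk li (esym aki); rewrite ali eqxx.
have mateN i : mate i = i \/ (mate i != i /\ a (mate i) = a i).
  by rewrite /mate; case: pickP => [l /andP[li /eqP]|] /=; [right|left].
have mate_push i : push t a (mate i) = push t a i.
  case: (mateN i) => [->//|[mi ai]].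
  rewrite (push_pair t sa mi ai) (@push_pair _ _ _ _ (mate i) sa) 1?eq_sym//.
have mateK : involutive mate.
  move=> i; case: (mateN i) => [E|[mi ai]]; first by rewrite !E.
  by apply: mateP => //; rewrite eq_sym.
have cc i : mate i != i -> c i + c (mate i) != 0.
  by move=> mi; apply: (pair_sum_neq0 sa mod); rewrite 1?eq_sym//; case: (mateN i) => [->//|[]].
pose c' i := if mate i == i then c0 i else
  (c0 i + c0 (mate i)) * ((c i + t * c (mate i)) / ((1 + t) * (c i + c (mate i)))).
have c'E : is_model (push t a) c'.
  case: mod0 => c0_ge0 E0; split=> [i|]; last rewrite -E0.
    rewrite /c'; case: eqVneq => // _; case: mod => c_ge0 _.
    apply: mulr_ge0; first exact: addr_ge0.
    by rewrite divr_ge0// ?mulr_ge0// ?addr_ge0// mulr_ge0.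
  apply/eqP; rewrite -subr_eq0 /arrow_poly opprB addrC addrA subrK.
  rewrite -sumrB; apply/eqP.
  rewrite -[RHS](@codiag_sum0 (push t a) (fun i => c0 i - c' i) mate)//; last first.
    move=> i; rewrite /c' mateK [i == _]eq_sym; case: eqVneq => [->|mi].
      by rewrite subrr oppr0.
    by have := cc i mi => h; field; rewrite t10 h.
  by apply: eq_bigr => i _; rewrite polyCB mulrBl.
exists c' => // i k j ik; have [->|kij] := eqVneq (closeness j a i k) 0; first by rewrite mul0r.
have [aik|aik] := eqVneq (a i) (a k).
  have mik : mate i = k by apply: mateP => //; rewrite eq_sym.
  have ki : k != i by rewrite eq_sym.
  have [j' aj] := box_pair sa ik aik.
  have jj : j' = j.
    have [] := closeness_near kij; rewrite aj => h _; apply: lam_close.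
    by apply: lt_trans h _; have := om_gt0; lra.
  subst j'.
  have := cc i; rewrite mik => /(_ ki) cik.
  have pik : push t a i = push t a k by rewrite -mik mate_push.
  have H : c' i * gaps2 (push t a) i k * (1 + t) = (c i + t * c k) * gaps2 a i k.
    have := model_gaps2 mod0 ik pik; rewrite (push_pair t sa ik aik).
    rewrite -(model_gaps2 mod ik aik) /c' mik (negPf ki) => E.
    set q := (c i + t * c k) / _.
    rewrite (_ : _ * q * _ * _ = (c0 i + c0 k) * gaps2 (push t a) i k * (q * (1 + t))); last by ring.
    by rewrite E /q; field; rewrite t10 cik.
  rewrite /weight_defect /closeness (push_pair t sa ik aik) (gaps2_pairC aik) -aik aj tent_lam.
  set P := cof j (lam j); rewrite !mulr1 mul1r.
  rewrite (_ : _ - _ = P * P * (c' i * gaps2 (push t a) i k * (1 + t) -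
    (c i + t * c k) * gaps2 a i k)); last by ring.
  by rewrite H subrr mulr0.
have aik0 : a i - a k != 0 by rewrite subr_eq0.
have ki : k != i by rewrite eq_sym.
apply/eqP; rewrite mulf_eq0; apply/orP; right; rewrite -(mulrI_eq0 _ (mulfI aik0)).
have phik : push t a k = a k - t * (closeness j a i k * (a i - lam j)).
  by rewrite /push (shift_near (j := j) sa ik) closenessC.
have phii : push t a i = a i - t * (closeness j a i k * (a k - lam j)).
  by rewrite /push (shift_near sa ki kij).
have := model_gaps i c'E; rewrite (gapsE _ ik) (spectral_cofactorE lam j).
have := model_gaps k mod; rewrite (gapsE _ ki) (spectral_cofactorE lam j).
have := model_gaps i mod; rewrite (gapsE _ ik) (spectral_cofactorE lam j).
rewrite /weight_defect; set u := closeness j a i k in phik phii *.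
set g1 := gaps2 a i k; set g2 := gaps2 a k i; set g3 := gaps2 (push t a) i k.
set P1 := cof j (a i); set P2 := cof j (a k); set P3 := cof j (push t a i).
move: P3 g3 phii phik; move: (push t a i) (push t a k) => pi pk P3 g3 -> ->.
move: (c i) (c k) (c' i) g1 g2 P1 P2 (a i) (a k) (lam j) => x y z g1 g2 P1 P2 A B L.
move=> E1 E2 E3; apply/eqP.
have E3' : z * g3 * ((1 + t * u) * (A - B)) = - ((A - t * (u * (B - L)) - L) * P3).
  by rewrite -E3; ring.
have E1' : x * g1 * (A - B) = - ((A - L) * P1) by rewrite -E1; ring.
have E2' : y * g2 * (A - B) = (B - L) * P2 by rewrite -[RHS]opprK -E2; ring.
transitivity (z * g3 * ((1 + t * u) * (A - B)) * P2 * P1 -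
  P3 * (x * g1 * (A - B) * P2 + t * u * (y * g2 * (A - B)) * P1)); first by ring.
by rewrite E1' E2' E3'; ring.
Qed.

End Deformation.

(** * The orbit model is compact *)

Section ModelSpace.
Variables (R : realType) (n : nat) (lam : 'I_n.+1 -> R).
Hypothesis lam_incr : forall i j : 'I_n.+1, (i < j)%N -> lam i < lam j.
Local Notation E := ('rV[R]_n * 'rV[R]_n)%type.

Definition model_space : set E :=
  [set p : E | is_model lam (p.1 ord0) (p.2 ord0)].

Lemma interval_boxesP (x : 'rV[R]_n) :
  interval_boxes lam x <-> exists s, in_box lam s (x ord0).
Proof.
split=> -[s sx]; exists s => i; have := sx i; rewrite /lam_interval /=.
  by rewrite in_itv.
by rewrite in_itv.
Qed.

(** The minimal distance between eigenvalues. *)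
Lemma exists_gap : exists2 om : R, 0 < om &
  forall i j : 'I_n.+1, (i < j)%N -> om <= lam j - lam i.
Proof.
pose gap (p : 'I_n) := hi lam p - lo lam p.
pose om := \big[Num.min/1]_p gap p.
have om_gap p : om <= gap p by rewrite /om (bigD1 p)//= ge_min lexx.
exists om.
  apply: (big_ind (fun x => 0 < x)) => // [x y x0 y0|p _]; first by rewrite lt_min x0.
  by rewrite subr_gt0; apply: lam_incr.
move=> i j ij; have jn : (j.-1 < n)%N by have := ltn_ord j; lia.
have hj : hi lam (Ordinal jn) = lam j.
  by rewrite /hi; congr lam; apply: val_inj; rewrite /= /bump leq0n; lia.
apply: le_trans (om_gap (Ordinal jn)) _; rewrite /gap hj lerD2l lerN2.
by apply: lam_le => //=; lia.
Qed.

Lemma cont_coord1 (X : topologicalType) (f : X -> E) i :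
  continuous f -> continuous (fun x => (f x).1 ord0 i).
Proof. by move=> cf; apply: cont_coord; exact: cont_comp cont_fst cf. Qed.

Lemma cont_coord2 (X : topologicalType) (f : X -> E) i :
  continuous f -> continuous (fun x => (f x).2 ord0 i).
Proof. by move=> cf; apply: cont_coord; exact: cont_comp cont_snd cf. Qed.

Lemma closed_model_space : closed model_space.
Proof.
pose f (z : R) (p : E) := (z - corner lam (p.1 ord0)) * \prod_i (z - p.1 ord0 i) -
  \sum_i p.2 ord0 i * \prod_(k | k != i) (z - p.1 ord0 k) - \prod_j (z - lam j).
have -> : model_space = [set p : E | forall i, 0 <= p.2 ord0 i] `&`
                        [set p | forall z, f z p = 0].
  apply/seteqP; split=> p [c_ge0 pE]; split=> //=.
    by move=> z; rewrite /f -horner_arrow_poly pE horner_spectral_poly subrr.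
    (* A polynomial over an infinite field is known from its values. *)
  apply: poly_ext => z; rewrite horner_arrow_poly horner_spectral_poly.
  by apply/eqP; rewrite -subr_eq0; apply/eqP; exact: pE.
have c1 (i : 'I_n) : continuous (fun p : E => p.1 ord0 i) by exact/cont_coord1/cont_id.
have c2 (i : 'I_n) : continuous (fun p : E => p.2 ord0 i) by exact/cont_coord2/cont_id.
have cz z (i : 'I_n) : continuous (fun p : E => z - p.1 ord0 i).
  by apply: cont_sub => //; exact: cont_cst.
apply: closedI; apply: closed_forall => z.
  by have /continuous_closedP /(_ _ (@closed_ge R 0)) := c2 z.
apply: closed_eq_fun; last exact: cont_cst.
apply: cont_sub; last exact: cont_cst.
apply: cont_sub; first apply: cont_mul.
- apply: cont_sub; first exact: cont_cst.
  by apply: cont_sub; [exact: cont_cst|exact: cont_sum].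
- exact: cont_prod.
- by apply: cont_sum => i _; apply: cont_mul => //; exact: cont_prod.
Qed.

Lemma corner_ge s a : in_box lam s a -> lam ord0 <= corner lam a.
Proof.
move=> sa; rewrite /corner big_ord_recl -addrA lerDl.
rewrite (reindex_inj (@perm_inj _ s)) -sumrB; apply: sumr_ge0 => i _.
by rewrite subr_ge0; have /andP[] := sa i.
Qed.

(** Evaluate the defining identity at lam_n + 1, where all factors X - a_k are at
    least 1. *)
Lemma model_bound a c i : is_model lam a c ->
  c i <= (lam ord_max + 1 - lam ord0) ^+ n.+1.
Proof.
move=> mod; have [s sa] := model_in_box lam_incr mod.
have a_ge k : lam ord0 <= a k.
  by have /andP[/(le_trans _)-> //] := sa k; exact: lam_le.
have a_le k : a k <= lam ord_max.
  by have /andP[_ /le_trans-> //] := sa k; apply: lam_le => //; rewrite -ltnS ltn_ord.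
set z := lam ord_max + 1; case: mod => c_ge0 /(congr1 (fun p : {poly R} => p.[z])).
rewrite horner_arrow_poly horner_spectral_poly => E0.
have za k : 1 <= z - a k by rewrite /z; have := a_le k; lra.
have P0 : 0 <= \prod_j (z - lam j).
  apply: prodr_ge0 => j _; have : lam j <= lam ord_max by apply: lam_le => //; rewrite -ltnS ltn_ord.
  by rewrite /z; lra.
have le1 : c i <= \sum_i c i * \prod_(k | k != i) (z - a k).
  rewrite (bigD1 i)//= -[X in X <= _]addr0 lerD//; last first.
    apply: sumr_ge0 => k _; apply: mulr_ge0 => //; apply: prodr_ge0 => l _.
    by apply: le_trans (za l).
  by rewrite ler_peMr//; apply: (big_ind (fun x => 1 <= x)) => // x y; exact: mulr_ege1.
apply: le_trans le1 _; rewrite -subr_ge0 in P0.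
have le2 : \sum_i c i * \prod_(k | k != i) (z - a k) <=
    (z - corner lam a) * \prod_i (z - a i).
  by rewrite -subr_ge0 E0 -[X in 0 <= X]subr0.
apply: (le_trans le2); rewrite exprS.
have D : \prod_i (z - a i) <= (z - lam ord0) ^+ n.
  rewrite -[X in _ ^+ X]card_ord -prodr_const; apply: ler_prod => k _.
  by rewrite (le_trans _ (za k))//= lerD2l lerN2.
apply: ler_pM => //.
- have Dpos : 0 < \prod_i (z - a i).
    by apply: prodr_gt0 => k _; exact: lt_le_trans (za k).
  rewrite -(pmulr_lge0 _ Dpos); apply: le_trans le2.
  apply: sumr_ge0 => k _; apply: mulr_ge0 => //; apply: prodr_ge0 => l _.
  exact: le_trans (za l).
- by apply: prodr_ge0 => k _; exact: le_trans (za k).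
- by rewrite lerD2l lerN2; exact: corner_ge sa.
Qed.

End ModelSpace.

(** * The diagonal map of the orbit model *)

Section ModelHomotopy.
Variables (R : realType) (n : nat) (lam : 'I_n.+1 -> R).
Hypothesis lam_incr : forall i j : 'I_n.+1, (i < j)%N -> lam i < lam j.
Local Notation E := ('rV[R]_n * 'rV[R]_n)%type.
Local Notation model := (model_space lam).
Local Notation boxes := (interval_boxes lam).

Lemma compact_model_space : compact model.
Proof.
pose B := (lam ord_max + 1 - lam ord0) ^+ n.+1.
pose K1 : set 'rV[R]_n := [set v | forall i, `[lam ord0, lam ord_max]%classic (v ord0 i)].
pose K2 : set 'rV[R]_n := [set v | forall i, `[0, B]%classic (v ord0 i)].
apply: (@subclosed_compact _ _ (K1 `*` K2)).
- exact: closed_model_space.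
- by apply: compact_setX;
    [apply: (@rV_compact _ n (fun=> `[lam ord0, lam ord_max]%classic))
    |apply: (@rV_compact _ n (fun=> `[0, B]%classic))] => i; exact: segment_compact.
move=> p mod; have [s sa] := model_in_box lam_incr mod; split=> i /=; rewrite in_itv /=.
  have /andP[h1 h2] := sa i; apply/andP; split.
    by apply: le_trans h1; exact: lam_le.
  by apply: (le_trans h2); apply: lam_le => //; rewrite -ltnS ltn_ord.
by have [c_ge0 _] := mod; rewrite c_ge0 (model_bound lam_incr i mod).
Qed.

Lemma model_box (q : model) : exists s, in_box lam s ((set_val q).1 ord0).
Proof. exact: (model_in_box lam_incr (set_valP q : is_model lam _ _)). Qed.

Definition model_diag (q : model) : boxes :=
  to_sub ((interval_boxesP lam _).2 (model_box q)).

Lemma model_diag_continuous : continuous model_diag.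
Proof.
apply: continuous_to_sub; apply: (@cont_comp _ _ _ set_val fst); first exact: cont_fst.
exact: val_continuous.
Qed.

Lemma model_diag_surj (x : boxes) : exists q, model_diag q = x.
Proof.
have /interval_boxesP[s /(box_model lam_incr)[c mod]] := set_valP x.
have mq : model_space lam (set_val x, \row_i c i).
  by rewrite /model_space /= row_ord0.
by exists (to_sub mq); apply: val_inj.
Qed.

Variable om : R.
Hypothesis om_gt0 : 0 < om.
Hypothesis om_gap : forall i j : 'I_n.+1, (i < j)%N -> om <= lam j - lam i.

Lemma cont_closeness (X : topologicalType) (f : X -> 'I_n -> R) j i k :
  (forall l, continuous (fun x => f x l)) ->
  continuous (fun x => closeness lam om j (f x) i k).
Proof.
move=> cf; have ctent l : continuous (fun x => tent lam om j (f x l)).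
  apply: cont_max; first exact: cont_cst.
  apply: cont_sub; first exact: cont_cst.
  apply: cont_mul; last exact: cont_cst.
  by apply: cont_norm; apply: cont_sub => //; exact: cont_cst.
by apply: cont_mul; exact: ctent.
Qed.

Lemma cont_push (X : topologicalType) (f : X -> 'I_n -> R) (t : X -> R) i :
  (forall l, continuous (fun x => f x l)) -> continuous t ->
  continuous (fun x => push lam om (t x) (f x) i).
Proof.
move=> cf ct; apply: cont_sub => //; apply: cont_mul => //.
apply: cont_sum => k _; apply: cont_sum => j _; apply: cont_mul; first exact: cont_closeness.
by apply: cont_sub => //; exact: cont_cst.
Qed.

(** The equations that determine the lift of [push] to the model. *)
Definition deform_graph : set ((model * R) * E) := [set z : (model * R) * E |
  (forall i, z.2.1 ord0 i = push lam om (clamp z.1.2) ((set_val z.1.1).1 ord0) i) /\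
  weight_rel lam om (clamp z.1.2) ((set_val z.1.1).1 ord0) (z.2.1 ord0)
      ((set_val z.1.1).2 ord0) (z.2.2 ord0)].

Lemma deform_exists (z : model * R) : exists y, model_space lam y /\ deform_graph (z, y).
Proof.
case: z => q t; have [s sa] := model_box q.
have [c' mc' rc'] := weights_exist lam_incr om_gt0 om_gap sa (clamp_ge0 t) (clamp_le1 t)
  (set_valP q : is_model lam _ _).
exists (\row_i push lam om (clamp t) ((set_val q).1 ord0) i, \row_i c' i).
by rewrite /model_space /deform_graph /= !row_ord0; split.
Qed.

Lemma deform_unique (z : model * R) y y' : model_space lam y -> model_space lam y' ->
  deform_graph (z, y) -> deform_graph (z, y') -> y' = y.
Proof.
case: z y y' => q t [a c] [a' c']; rewrite /model_space /deform_graph /=.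
move=> m m' [/funext aE r] [/funext a'E r']; have [s sa] := model_box q.
congr pair; apply/rowP => i; first by rewrite a'E aE.
rewrite aE in m r; rewrite a'E in m' r'.
exact: (weights_unique lam_incr om_gt0 om_gap sa (clamp_ge0 t) (clamp_le1 t) m' m r' r).
Qed.

Lemma closed_deform_graph : closed deform_graph.
Proof.
have cq : continuous (fun z : (model * R) * E => set_val z.1.1).
  apply: (cont_comp (@val_continuous _ _)).
  by apply: (cont_comp cont_fst); exact: cont_fst.
have ct : continuous (fun z : (model * R) * E => clamp z.1.2).
  apply: (cont_comp (@clamp_continuous R)).
  by apply: (cont_comp cont_snd); exact: cont_fst.
have cy : continuous (fun z : (model * R) * E => z.2) by exact: cont_snd.
have ca i : continuous (fun z : (model * R) * E => (set_val z.1.1).1 ord0 i).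
  exact: cont_coord1 cq.
have cc i : continuous (fun z : (model * R) * E => (set_val z.1.1).2 ord0 i).
  exact: cont_coord2 cq.
have ca' i : continuous (fun z : (model * R) * E => z.2.1 ord0 i).
  exact: cont_coord1 cy.
have cc' i : continuous (fun z : (model * R) * E => z.2.2 ord0 i).
  exact: cont_coord2 cy.
have ckap j i k : continuous (fun z : (model * R) * E =>
    closeness lam om j ((set_val z.1.1).1 ord0) i k).
  exact: cont_closeness.
have ccof j (f : (model * R) * E -> R) : continuous f ->
    continuous (fun z => spectral_cofactor lam j (f z)).
  by move=> cf; apply: cont_prod => m _; apply: cont_sub => //; exact: cont_cst.
have cgaps i k (f : 'I_n -> (model * R) * E -> R) : (forall i, continuous (f i)) ->
    continuous (fun z => gaps2 (f^~ z) i k).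
  by move=> cf; apply: cont_prod => l _; apply: cont_sub.
apply: closedI; first apply: closed_forall => i.
  apply: closed_eq_fun; first exact: ca'.
  exact: cont_push.
apply: closed_forall => i; apply: closed_forall => k; apply: closed_forall => j.
apply: closed_forall => ik; apply: closed_eq_fun; last exact: cont_cst.
apply: cont_mul; first exact: ckap.
rewrite /weight_defect; apply: cont_sub.
  apply: cont_mul; last by apply: ccof; exact: ca.
  apply: cont_mul; last by apply: ccof; exact: ca.
  apply: cont_mul; last first.
    by apply: cont_add; [exact: cont_cst|apply: cont_mul; [exact: ct|exact: ckap]].
  apply: cont_mul; first exact: cc'.
  by apply: (cgaps _ _ (fun i z => z.2.1 ord0 i)).
apply: cont_mul; first by apply: ccof; exact: ca'.
apply: cont_add; last first.
  apply: cont_mul; last by apply: ccof; exact: ca.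
  apply: cont_mul; last by apply: (cgaps _ _ (fun i z => (set_val z.1.1).1 ord0 i)).
  apply: cont_mul; last exact: cc.
  by apply: cont_mul; [exact: ct|exact: ckap].
apply: cont_mul; last by apply: ccof; exact: ca.
apply: cont_mul; first exact: cc.
by apply: (cgaps _ _ (fun i z => (set_val z.1.1).1 ord0 i)).
Qed.

Definition deform (z : model * R) : model :=
  to_sub (proj1 (projT2 (cid (deform_exists z)))).

Lemma deformP z : deform_graph (z, set_val (deform z)).
Proof. exact: (proj2 (projT2 (cid (deform_exists z)))). Qed.

Lemma deformE z q : deform_graph (z, set_val q) -> deform z = q.
Proof.
move=> h; apply: val_inj; apply: (deform_unique _ _ h (deformP z)); exact: set_valP.
Qed.

Lemma deform_continuous : continuous deform.
Proof.
apply: continuous_to_sub.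
apply: (closed_graph_continuous compact_model_space closed_deform_graph).
- by move=> z; exact: set_valP.
- exact: deformP.
- move=> z y my h; apply: (deform_unique _ my (deformP z) h); exact: set_valP.
Qed.

Lemma deform0 q : deform (q, 0) = q.
Proof.
apply: deformE; rewrite /deform_graph /= clamp0//; split=> [i|i k j ik].
  by rewrite /push mul0r subr0.
by rewrite /weight_defect !mul0r !addr0 mulr1; ring.
Qed.

(** At time 1 a double entry receives half of the sum of the two weights, and this
    sum is determined by the diagonal. *)
Lemma deform1 q q' : model_diag q = model_diag q' -> deform (q, 1) = deform (q', 1).
Proof.
move=> eq_diag.
have qq' : (set_val q).1 = (set_val q').1 := congr1 set_val eq_diag.
have := deformP (q, 1); have := deformP (q', 1).
have := set_valP (deform (q, 1)); have := set_valP (deform (q', 1)).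
move=> m' m [a'E r'] [aE r].
suff E : set_val (deform (q, 1)) = set_val (deform (q', 1)) by exact: val_inj.
move: m' m a'E r' aE r.
move: (deform (q, 1)) (deform (q', 1)) => [[a1 c1] ?] [[a2 c2] ?].
rewrite /model_space /= -qq' clamp1// => m' m /funext a'E r' /funext aE r.
rewrite a'E in m' r'; rewrite aE in m r.
congr pair; apply/rowP => i; first by rewrite aE a'E.
have [s sa] := model_box q.
apply: (weights_unique lam_incr om_gt0 om_gap sa _ _ m m' r r' _ i) => // {}i k ik aik.
rewrite !mul1r (model_gaps2 (set_valP q : is_model lam _ _) ik aik).
have := set_valP q'; rewrite /model_space /= -qq' => mq'.
by rewrite (model_gaps2 mq' ik aik).
Qed.

(** Any point above [x] may be chosen, by [deform1]. *)
Definition model_lift (x : boxes) : model :=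
  deform (projT1 (cid (model_diag_surj x)), 1).

Lemma model_liftK q : model_lift (model_diag q) = deform (q, 1).
Proof. by rewrite /model_lift; case: cid => q' /= /deform1. Qed.

Lemma model_lift_continuous : continuous model_lift.
Proof.
apply: (compact_surj_continuous compact_model_space (@hausdorff_rV R n)
  model_diag_continuous model_diag_surj).
have -> : model_lift \o model_diag = fun q => deform (q, 1).
  by apply/funext => q; exact: model_liftK.
apply: (cont_comp deform_continuous); apply: cont_pair; first exact: cont_id.
exact: cont_cst.
Qed.

Lemma push_boxes (z : boxes * R) :
  interval_boxes lam (\row_i push lam om (clamp z.2) ((set_val z.1) ord0) i).
Proof.
case: z => x t /=; have /interval_boxesP[s sa] := set_valP x.
apply/interval_boxesP; exists s; rewrite row_ord0.
exact: (push_box lam_incr om_gt0 om_gap sa (clamp_ge0 t) (clamp_le1 t)).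
Qed.

Lemma model_lift_diag : homotopic_total R (model_lift \o model_diag) id.
Proof.
apply: homotopic_total_sym; exists deform; split; first exact: deform_continuous.
  exact: deform0.
by move=> q; rewrite /= model_liftK.
Qed.

Lemma model_diag_lift : homotopic_total R (model_diag \o model_lift) id.
Proof.
apply: homotopic_total_sym; exists (fun z => to_sub (push_boxes z)); split.
- apply: continuous_to_sub; apply: continuous_mx => i j /=.
  under eq_fun do rewrite mxE.
  apply: cont_push => [l|]; last first.
    by apply: (cont_comp (@clamp_continuous R)); exact: cont_snd.
  by apply: cont_coord; apply: (cont_comp (@val_continuous _ _)); exact: cont_fst.
- move=> x; apply: val_inj; apply/rowP => i.
  by rewrite /= !mxE clamp0// /push mul0r subr0.
- move=> x; apply: val_inj; rewrite /= /model_lift; case: cid => q /= qx.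
  have [aE _] := deformP (q, 1); apply/rowP => i; rewrite aE mxE /= clamp1//.
  by rewrite -qx.
Qed.

End ModelHomotopy.

(** * Cells of the permutohedron given by levels *)

Section Levels.
Variables (R : realType) (n : nat).
Implicit Types (b : 'I_n -> nat) (x y : 'rV[R]_n).

(** A function [b] to the naturals encodes an ordered partition, with the fibres
    as blocks.  The block of [i] occupies the positions from [below b i] to
    [upto b i - 1], counted from 0. *)
Definition below b i := #|[pred k | (b k < b i)%N]|.
Definition upto b i := #|[pred k | (b k <= b i)%N]|.

Definition cubical_level b : Prop :=
  forall i k l, b i = b k -> b i = b l -> [\/ i = k, k = l | i = l].

(** The equations and inequalities of a cubical face of the permutohedron. *)
Definition cell b : set 'rV[R]_n := [set x | [/\
  forall i, (below b i).+1%:R <= x ord0 i <= (below b i).+2%:R,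
  forall i, (forall k, b k = b i -> k = i) -> x ord0 i = (below b i).+1%:R &
  forall i k, i != k -> b i = b k -> x ord0 i + x ord0 k = (below b i + below b i + 3)%:R]].

Lemma upto_below b i k : (b i < b k)%N -> (upto b i <= below b k)%N.
Proof.
move=> ik; apply/subset_leq_card/fintype.subsetP => l; rewrite !inE => /leq_ltn_trans.
exact.
Qed.

Lemma upto_le b i : (upto b i <= n)%N.
Proof. by rewrite -[X in (_ <= X)%N]card_ord; exact: max_card. Qed.

Lemma upto_split b i : upto b i = (below b i + #|[pred k | b k == b i]|)%N.
Proof.
rewrite /upto -(cardID [pred k | (b k < b i)%N]); congr (_ + _)%N; apply: eq_card => k.
  by rewrite !inE; case: ltngtP.
by rewrite !inE; case: ltngtP.
Qed.

Lemma below_upto b i : (below b i < upto b i)%N.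
Proof.
rewrite upto_split -addn1 leq_add2l; apply/card_gt0P; exists i.
by rewrite inE.
Qed.

Lemma below_upto2 b i k : i != k -> b i = b k -> (below b i + 2 <= upto b i)%N.
Proof.
move=> ik bik; rewrite upto_split leq_add2l.
rewrite (cardD1 i) (cardD1 k) !inE eqxx bik eqxx eq_sym ik /=.
by rewrite addnA leq_addr.
Qed.

Lemma below_eq b i k : b i = b k -> below b i = below b k.
Proof. by move=> bik; rewrite /below bik. Qed.

Lemma card_level2 b i k : cubical_level b -> i != k -> b i = b k ->
  forall l, b l = b i -> l = i \/ l = k.
Proof.
move=> cb ik bik l bl; case: (cb i k l bik (esym bl)) => e; last by left.
  by rewrite e eqxx in ik.
by right.
Qed.

Lemma level_cases b i : (forall k, b k = b i -> k = i) \/ exists2 k, i != k & b i = b k.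
Proof.
have [[k ik bik]|no] := pselect (exists2 k, i != k & b i = b k); first by right; exists k.
left=> k bki; apply/eqP/negPn/negP => ki; apply: no; exists k; first by rewrite eq_sym.
by rewrite bki.
Qed.

Lemma cell_convex b x y (t : R) : cell b x -> cell b y -> 0 <= t -> t <= 1 ->
  cell b (t *: x + (1 - t) *: y).
Proof.
move=> [x1 x2 x3] [y1 y2 y3] t0 t1; split.
- move=> i; rewrite !mxE; have /andP[? ?] := x1 i; have /andP[? ?] := y1 i.
  by apply/andP; split; nra.
- by move=> i hi; rewrite !mxE (x2 i hi) (y2 i hi); ring.
- move=> i k ik bik; rewrite !mxE.
  transitivity (t * (x ord0 i + x ord0 k) + (1 - t) * (y ord0 i + y ord0 k)); first by ring.
  by rewrite (x3 _ _ ik bik) (y3 _ _ ik bik); ring.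
Qed.

Definition compatible b (s : 'S_n) : Prop :=
  forall i k, (b i < b k)%N -> (s i < s k)%N.

Lemma compatible_range b s i : compatible b s -> (below b i <= s i < upto b i)%N.
Proof.
move=> bs; apply/andP; split.
  rewrite -[X in (_ <= X)%N](card_perm_lt s (ltnW (ltn_ord (s i)))).
  by apply/subset_leq_card/fintype.subsetP => k; rewrite !inE => /bs.
rewrite -[X in (X <= _)%N](card_perm_lt s (ltn_ord (s i))).
apply/subset_leq_card/fintype.subsetP => k; rewrite !inE ltnS.
by apply: contraTT; rewrite -!ltnNge => /bs.
Qed.

Lemma compatible_cell b s : cubical_level b -> compatible b s -> cell b (vertex R s).
Proof.
move=> cb bs.
have up i : (upto b i <= below b i + 2)%N.
  rewrite upto_split leq_add2l; have [no|[k ik bik]] := level_cases b i.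
    rewrite (fintype.eq_card1 (x := i))// => k; rewrite !inE; apply/eqP/eqP => [/no//|->//].
  have c2 : #|pred2 i k| = 2 by rewrite card2 ik.
  rewrite -[X in (_ <= X)%N]c2; apply/subset_leq_card/fintype.subsetP => l; rewrite !inE => /eqP.
  by case/(card_level2 cb ik bik) => ->; rewrite eqxx ?orbT.
split.
- move=> i; rewrite mxE !ler_nat; have /andP[h1 h2] := compatible_range i bs.
  by rewrite ltnS h1 /= -addn2; apply: leq_trans h2 (up i).
- move=> i no; rewrite mxE; congr (_%:R); congr S.
  have := compatible_range i bs; rewrite upto_split (fintype.eq_card1 (x := i)); first by lia.
  by move=> k; rewrite !inE; apply/eqP/eqP => [/no//|->//].
- move=> i k ik bik; rewrite !mxE -natrD; congr (_%:R).
  have := compatible_range i bs; have := compatible_range k bs.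
  have := up i; have : (s i : nat) != s k by rewrite (inj_eq val_inj) (inj_eq perm_inj).
  rewrite (below_eq bik) /upto bik -/(upto b k); lia.
Qed.

Lemma cell_vertex b x : cubical_level b -> cell b x ->
  (forall i, x ord0 i = (below b i).+1%:R \/ x ord0 i = (below b i).+2%:R) ->
  exists2 s, compatible b s & x = vertex R s.
Proof.
move=> cb [x1 x2 x3] x12.
(* The entry of [x] minus 1, as a natural number. *)
pose f i := if x ord0 i == (below b i).+1%:R then below b i else (below b i).+1.
have fE i : x ord0 i = (f i).+1%:R.
  by rewrite /f; case: eqP => // ne; case: (x12 i).
have fu i : (f i < upto b i)%N.
  rewrite /f; case: eqP => [_|ne]; first exact: below_upto.
  have [/x2//|[k ik bik]] := level_cases b i.
  by have := below_upto2 ik bik; rewrite addn2.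
have f_lt i k : (b i < b k)%N -> (f i < f k)%N.
  move=> bik; apply: leq_trans (fu i) (leq_trans (upto_below bik) _).
  by rewrite /f; case: eqP.
have fn i : (f i < n)%N by exact: leq_trans (fu i) (upto_le b i).
have finj : injective (fun i => Ordinal (fn i)).
  move=> i k /(congr1 val) /= fik; apply/eqP/negPn/negP => ik.
  case: (ltngtP (b i) (b k)) => [/f_lt|/f_lt|bik]; rewrite ?fik ?ltnn//.
  have := x3 i k ik bik; rewrite !fE fik -natrD => /eqP; rewrite eqr_nat; lia.
exists (perm finj) => [i k /f_lt|]; first by rewrite !permE.
by apply/rowP => i; rewrite mxE permE /= fE.
Qed.

(** A cell is a cube.  As long as some entry is not at an end of its range, the
    point lies on a segment between two points of the cell at which this entry and
    its partner are at the ends. *)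
Lemma cell_hull b x (A : set 'rV[R]_n) : cubical_level b -> cell b x ->
  (forall y z (t : R), A y -> A z -> 0 <= t -> t <= 1 -> A (t *: y + (1 - t) *: z)) ->
  (forall s, compatible b s -> A (vertex R s)) -> A x.
Proof.
move=> cb cx cA Av.
pose bad x : pred 'I_n := fun i =>
  (x ord0 i != (below b i).+1%:R) && (x ord0 i != (below b i).+2%:R).
have [m] := ubnP #|bad x|; elim: m => // m IHm in x cx *; rewrite ltnS => mx.
have [[i badi]|nobad] := pselect (exists i, bad x i); last first.
  have [i|s bs ->] := cell_vertex cb cx; last exact: Av.
  have [->|n1] := eqVneq (x ord0 i) (below b i).+1%:R; first by left.
  have [->|n2] := eqVneq (x ord0 i) (below b i).+2%:R; first by right.
  by case: nobad; exists i; rewrite /bad n1.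
case: (cx) => x1 x2 x3; have [/x2 xi|[k ik bik]] := level_cases b i.
  by move: badi; rewrite /bad xi eqxx.
have ki : k != i by rewrite eq_sym.
pose upd (u v : R) : 'rV[R]_n := \row_l if l == i then u else if l == k then v else x ord0 l.
have updi u v : upd u v ord0 i = u by rewrite mxE eqxx.
have updk u v : upd u v ord0 k = v by rewrite mxE (negPf ki) eqxx.
have updl u v l : l != i -> l != k -> upd u v ord0 l = x ord0 l.
  by move=> li lk; rewrite mxE (negPf li) (negPf lk).
have lik : forall l, b l = b i -> l = i \/ l = k := card_level2 cb ik bik.
set N := below b i in badi *.
have Nk : below b k = N by rewrite -(below_eq bik).
have upd_cell u v : (u = N.+1%:R /\ v = N.+2%:R) \/ (u = N.+2%:R /\ v = N.+1%:R) ->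
    cell b (upd u v).
  move=> uv; have uvN : u + v = (N + N + 3)%:R.
    by case: uv => -[-> ->]; rewrite -natrD; congr (_%:R); lia.
  have uv1 : N.+1%:R <= u <= N.+2%:R /\ N.+1%:R <= v <= N.+2%:R.
    by case: uv => -[-> ->]; rewrite !ler_nat !leqnn !leqnSn.
  split.
  - move=> l; have [->|li] := eqVneq l i; first by rewrite updi -/N; case: uv1.
    have [->|lk] := eqVneq l k; first by rewrite updk Nk; case: uv1.
    by rewrite updl.
  - move=> l no; have li : l != i.
      by apply/eqP => li; move: ki; rewrite (no k) ?li ?eqxx// -bik -li.
    have lk : l != k.
      by apply/eqP => lk; move: ik; rewrite (no i) ?lk ?eqxx// bik -lk.
    by rewrite updl// x2.
  - move=> l l' ll' bll'; have [li|li] := eqVneq l i.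
      subst l; have l'k : l' = k by case: (lik l') => // l'i; rewrite l'i eqxx in ll'.
      by rewrite l'k updi updk.
    have [lk|lk] := eqVneq l k.
      subst l; have l'i : l' = i.
        by case: (lik l') => //; [rewrite -bll' bik|move=> l'k; rewrite l'k eqxx in ll'].
      by rewrite l'i updi updk Nk addrC.
    have l'i : l' != i.
      apply/eqP => e; case: (lik l); rewrite ?bll' ?e// => e'.
        by rewrite e' eqxx in li.
      by rewrite e' eqxx in lk.
    have l'k : l' != k.
      apply/eqP => e; case: (lik l); rewrite ?bll' ?e ?bik// => e'.
        by rewrite e' eqxx in li.
      by rewrite e' eqxx in lk.
    by rewrite !updl// x3.
have upd_bad u v : (u = N.+1%:R /\ v = N.+2%:R) \/ (u = N.+2%:R /\ v = N.+1%:R) ->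
    (#|bad (upd u v)| < m)%N.
  move=> uv; apply: leq_trans mx; apply: proper_card; apply/properP; split.
    apply/fintype.subsetP => l; rewrite !unfold_in /bad.
    have [->|li] := eqVneq l i.
      by rewrite updi -/N; case: uv => -[-> _]; rewrite eqxx ?andbF.
    have [->|lk] := eqVneq l k.
      by rewrite updk Nk; case: uv => -[_ ->]; rewrite eqxx ?andbF.
    by rewrite updl.
  exists i; first exact: badi.
  by rewrite unfold_in /bad updi -/N; case: uv => -[-> _]; rewrite eqxx ?andbF.
have h1 : (N.+1%:R = N.+1%:R :> R /\ N.+2%:R = N.+2%:R :> R) \/
          (N.+1%:R = N.+2%:R :> R /\ N.+2%:R = N.+1%:R :> R) by left.
have h2 : (N.+2%:R = N.+1%:R :> R /\ N.+1%:R = N.+2%:R :> R) \/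
          (N.+2%:R = N.+2%:R :> R /\ N.+1%:R = N.+1%:R :> R) by right.
have A1 := IHm _ (upd_cell _ _ h1) (upd_bad _ _ h1).
have A2 := IHm _ (upd_cell _ _ h2) (upd_bad _ _ h2).
have /andP[xi1 xi2] := x1 i; have xik := x3 i k ik bik.
have NE : (N.+2%:R : R) = N.+1%:R + 1 by rewrite -[in LHS]addn1 natrD.
have -> : x = (N.+2%:R - x ord0 i) *: upd N.+1%:R N.+2%:R +
    (1 - (N.+2%:R - x ord0 i)) *: upd N.+2%:R N.+1%:R.
  apply/rowP => l; rewrite [RHS]mxE [X in _ = X + _]mxE [X in _ = _ + X]mxE.
  have [->|li] := eqVneq l i; first by rewrite !updi NE; ring.
  have [->|lk] := eqVneq l k.
    rewrite !updk; have -> : x ord0 k = (N + N + 3)%:R - x ord0 i by rewrite -xik; ring.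
    have -> : (N + N + 3)%:R = N.+1%:R + N.+2%:R :> R by rewrite -natrD; congr (_%:R); lia.
    by rewrite NE; ring.
  by rewrite !updl//; ring.
by apply: cA => //; rewrite -/N in xi1 xi2; rewrite NE in xi2 *; lra.
Qed.

End Levels.

Arguments cell R {n} b _.

(** * Faces of ordered partitions *)

Section Faces.
Variables (R : realType) (n : nat).
Implicit Types (S : seq {set 'I_n}) (s : 'S_n).

Definition block_index S (i : 'I_n) := find (fun B : {set 'I_n} => i \in B) S.

Lemma cover_seq S i : ordered_partition S -> has (fun B : {set 'I_n} => i \in B) S.
Proof.
case/andP => _ /and3P[/eqP cov _ _]; have : i \in finset.cover [set:: S]%SET by rewrite cov inE.
by case/bigcupP => B; rewrite inE => BS iB; apply/hasP; exists B.
Qed.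

Lemma block_index_lt S i : ordered_partition S -> (block_index S i < size S)%N.
Proof. by move=> oS; rewrite -has_find cover_seq. Qed.

Lemma mem_block_index S i m : ordered_partition S -> (m < size S)%N ->
  (i \in nth finset.set0 S m) = (block_index S i == m).
Proof.
move=> oS mS; apply/idP/eqP => [im|<-]; last exact: (nth_find _ (cover_seq i oS)).
have iB := nth_find finset.set0 (cover_seq i oS); have lt := block_index_lt i oS.
case/andP: oS => uS /and3P[_ /finset.trivIsetP tr _].
apply/eqP; rewrite -(nth_uniq finset.set0 lt mS uS); apply/negPn/negP => ne.
have := tr _ _ _ _ ne; rewrite !inE !mem_nth// => /(_ isT isT) /pred0P/(_ i) /=.
by rewrite im iB.
Qed.

Local Notation Bl s k := ([set i | s i == k]%SET).

(** In the vertex partition of [s] the singletons are listed by increasing [s], and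
    consecutive runs of it are merged. *)
Lemma refines_compatible S s : ordered_partition S ->
  refines (vertex_partition s) S -> compatible (block_index S) s.
Proof.
move=> oS [ss flE SE] i k ik.
pose Rb (B B' : {set 'I_n}) := [forall x in B, forall y in B', (s x < s y)%N].
have pw : pairwise Rb (flatten ss).
  rewrite -flE /vertex_partition pairwise_map.
  have : pairwise (relpre val ltn) (enum 'I_n).
    by rewrite -pairwise_map val_enum_ord -sorted_pairwise ?iota_ltn_sorted//; exact: ltn_trans.
  apply: sub_pairwise => p q pq; apply/forall_inP => x; rewrite inE => /eqP->.
  by apply/forall_inP => y; rewrite inE => /eqP->.
have find_in j : exists2 B, B \in nth [::] ss (block_index S j) & j \in B.
  have := mem_block_index j oS (block_index_lt j oS); rewrite eqxx.
  rewrite [in X in nth _ X _]SE (nth_map [::]); last first.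
    by rewrite -[size ss](size_map (fun r => \bigcup_(B <- r) B)%SET) -SE block_index_lt.
  rewrite finset.bigcup_seq => /bigcupP[B Bss jB]; by exists B.
have [B Bss iB] := find_in i; have [B' Bss' kB'] := find_in k.
have szk : (block_index S k < size ss)%N.
  by rewrite -[size ss](size_map (fun r => \bigcup_(B <- r) B)%SET) -SE block_index_lt.
move: pw; rewrite -(cat_take_drop (block_index S k) ss) flatten_cat pairwise_cat.
case/andP => /allrelP al _.
have /forall_inP/(_ i iB)/forall_inP/(_ k kB')// : Rb B B'.
apply: al; apply/flattenP.
  exists (nth [::] ss (block_index S i)) => //.
  by rewrite -(nth_take _ ik) mem_nth// size_take szk.
exists (nth [::] ss (block_index S k)) => //.
by rewrite -[X in nth _ _ X]addn0 -nth_drop mem_nth// size_drop subn_gt0.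
Qed.

Lemma filter_ltnS (T : eqType) (f : T -> nat) m (L : seq T) :
  pairwise (fun p q => f p <= f q)%N L ->
  [seq p <- L | (f p < m.+1)%N] =
  [seq p <- L | (f p < m)%N] ++ [seq p <- L | f p == m].
Proof.
elim: L => //= p L IHL /andP[pL /IHL E]; rewrite ltnS.
case: (ltngtP (f p) m) => pm /=; rewrite ?E//.
have -> : [seq q <- L | (f q < m)%N] = [::]; last by [].
rewrite (eq_in_filter (a2 := pred0)) ?filter_pred0// => q qL /=.
by apply/negbTE; rewrite -leqNgt -pm; move/allP: pL; exact.
Qed.

Lemma flatten_filter_levels (T : eqType) (f : T -> nat) m (L : seq T) :
  pairwise (fun p q => f p <= f q)%N L ->
  flatten [seq [seq p <- L | f p == l] | l <- iota 0 m] =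
  [seq p <- L | (f p < m)%N].
Proof.
move=> pL; elim: m => [|m IHm]; first by rewrite filter_pred0.
by rewrite -addn1 iotaD map_cat flatten_cat IHm /= cats0 add0n addn1 filter_ltnS.
Qed.

(** The singletons of each block, sorted by [s], form the runs; monotonicity makes
    their concatenation the whole list. *)
Lemma compatible_refines S s : ordered_partition S ->
  compatible (block_index S) s -> refines (vertex_partition s) S.
Proof.
move=> oS bs; pose f (p : 'I_n) := block_index S ((s^-1)%g p).
pose L m := [seq p <- enum 'I_n | f p == m].
exists [seq [seq Bl s p | p <- L m] | m <- iota 0 (size S)].
  rewrite (map_comp (map (fun p => Bl s p)) L) -map_flatten flatten_filter_levels.
    rewrite (eq_in_filter (a2 := predT)) ?filter_predT// => p _ /=.
    exact: block_index_lt.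
  have : pairwise (relpre val ltn) (enum 'I_n).
    by rewrite -pairwise_map val_enum_ord -sorted_pairwise ?iota_ltn_sorted//; exact: ltn_trans.
  apply: sub_pairwise => p q /= pq; rewrite /f leqNgt; apply/negP => /bs.
  by rewrite !permKV ltnNge ltnW.
rewrite -map_comp; apply: (@eq_from_nth _ finset.set0) => [|m mS].
  by rewrite size_map size_iota.
rewrite (nth_map 0%N) ?size_iota// nth_iota//= add0n big_map.
apply/setP => i; rewrite mem_block_index// finset.bigcup_seq; apply/eqP/bigcupP.
  move=> im; exists (s i); last by rewrite inE.
  by rewrite mem_filter mem_enum andbT /f permK im.
by case=> p; rewrite mem_filter => /andP[/eqP <- _]; rewrite inE => /eqP <-; rewrite /f permK.
Qed.

Lemma face_hull S (A : set 'rV[R]_n) :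
  (forall y z (t : R), A y -> A z -> 0 <= t -> t <= 1 -> A (t *: y + (1 - t) *: z)) ->
  (forall s, refines (vertex_partition s) S -> A (vertex R s)) ->
  face S `<=` A.
Proof.
move=> cA Av x; apply; split; last by move=> _ [s sS <-]; exact: Av.
move=> y z t; rewrite !inE => Ay Az; apply: cA => //.
- exact: interval_inference.ge0.
- exact: interval_inference.le1.
Qed.

Lemma face_convex S y z (t : R) : face S y -> face S z -> 0 <= t -> t <= 1 ->
  face S (t *: y + (1 - t) *: z).
Proof.
move=> Sy Sz t0 t1 A [cA Av].
have := cA y z (interval_inference.Itv01 t0 t1).
rewrite !inE /=; apply; [exact: Sy|exact: Sz].
Qed.

Lemma block_level S : cubical S -> ordered_partition S -> cubical_level (block_index S).
Proof.
move=> cS oS i k l ik il.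
have [->|nik] := eqVneq i k; first by constructor 1.
have [->|nkl] := eqVneq k l; first by constructor 2.
have [->|nil] := eqVneq i l; first by constructor 3.
exfalso; have := allP cS (nth finset.set0 S (block_index S i)) (mem_nth _ (block_index_lt i oS)).
rewrite leqNgt => /negP; apply.
have c3 : #|[set i; k; l]%SET| = 3 by rewrite -finset.setUA cardsU1 !inE cards2 nkl (negPf nik) (negPf nil).
rewrite -[X in (X <= _)%N]c3; apply/subset_leq_card/fintype.subsetP => j; rewrite !inE mem_block_index ?block_index_lt//.
by move=> /orP[/orP[]|] /eqP->; rewrite ?ik -?ik ?il.
Qed.

Lemma face_cell S : ordered_partition S -> cubical S -> face S = cell R (block_index S).
Proof.
move=> oS cS; have cb := block_level cS oS; apply/seteqP; split.
  apply: face_hull; first by move=> y z t; exact: cell_convex.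
  by move=> s sS; apply: compatible_cell => //; exact: refines_compatible.
move=> x cx; apply: (cell_hull cb cx); first by move=> y z t; exact: face_convex.
move=> s bs A [_ Av]; apply: Av; exists s => //=.
exact: compatible_refines.
Qed.

(** The nonempty fibres of [b], listed by increasing value. *)
Lemma level_partition (b : 'I_n -> nat) :
  exists2 S, ordered_partition S &
    forall i k, (block_index S i < block_index S k)%N = (b i < b k)%N.
Proof.
pose L := sort leq (undup [seq b i | i <- enum 'I_n]).
have uL : uniq L by rewrite sort_uniq undup_uniq.
have memL m : (m \in L) = [exists i, b i == m].
  rewrite mem_sort mem_undup; apply/mapP/existsP => [[i _ ->]|[i /eqP<-]]; exists i => //.
  by rewrite mem_enum.
pose Bk m : {set 'I_n} := [set i | b i == m]%SET.
have Bk_inj : {in L &, injective Bk}.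
  move=> m m'; rewrite memL => /existsP[i /eqP bi] _ /setP/(_ i); rewrite !inE bi eqxx.
  by move=> /esym/eqP.
have idx i : block_index (map Bk L) i = index (b i) L.
  rewrite /block_index find_map; apply: eq_find => m /=.
  by rewrite inE eq_sym.
have sL : sorted ltn L.
  by rewrite ltn_sorted_uniq_leq uL sort_sorted//; exact: leq_total.
exists (map Bk L).
  rewrite /ordered_partition map_inj_in_uniq// uL /=; apply/and3P; split.
  - apply/eqP/setP => i; rewrite inE; apply/bigcupP; exists (Bk (b i)); rewrite inE// .
    by apply: map_f; rewrite memL; apply/existsP; exists i.
  - apply/finset.trivIsetP => A B; rewrite !inE => /mapP[m _ ->] /mapP[m' _ ->] ne.
    apply/pred0P => i /=; rewrite !inE; apply/negP => /andP[/eqP e /eqP e'].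
    by rewrite -e -e' eqxx in ne.
  - rewrite inE; apply/negP => /mapP[m]; rewrite memL => /existsP[i bi] /setP/(_ i).
    by rewrite !inE bi.
move=> i k; rewrite !idx.
have iL : b i \in L by rewrite memL; apply/existsP; exists i.
have kL : b k \in L by rewrite memL; apply/existsP; exists k.
apply/idP/idP; first exact: (sorted_ltn_index ltn_trans sL).
move=> bik; rewrite ltnNge leq_eqVlt; apply/negP => /orP[/eqP e|].
  by move: bik; rewrite -(nth_index 0%N iL) -e nth_index// ltnn.
by move=> /(sorted_ltn_index ltn_trans sL _ _ kL iL)/(ltn_trans bik); rewrite ltnn.
Qed.

Lemma eq_ltnE (m p : nat) : (m == p) = ~~ (m < p)%N && ~~ (p < m)%N.
Proof. by case: ltngtP. Qed.

Lemma cell_eq (b b' : 'I_n -> nat) :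
  (forall i k, (b i < b k)%N = (b' i < b' k)%N) -> cell R b = cell R b'.
Proof.
move=> bb'.
have E i k : b i = b k <-> b' i = b' k.
  have Eb : (b i == b k) = (b' i == b' k) by rewrite !eq_ltnE !bb'.
  by split=> /eqP; [rewrite Eb|rewrite -Eb] => /eqP.
have N i : below b i = below b' i by apply: eq_card => k; rewrite !inE bb'.
apply/seteqP; split=> x [x1 x2 x3]; split=> [i|i no|i k ik bik].
- by rewrite -N.
- by rewrite -N x2// => k /E/no.
- by rewrite -N x3//; apply/E.
- by rewrite N.
- by rewrite N x2// => k /E/no.
- by rewrite N x3//; apply/E.
Qed.

(** Only the order and the coincidences of the levels matter, by [cell_eq], so
    arbitrary levels are as good as block indices. *)
Lemma cubical_complexP x : cubical_complex R n x <->
  exists2 b, cubical_level b & cell R b x.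
Proof.
split=> [[S [oS cS]]|[b cb cx]].
  by rewrite face_cell// => cx; exists (block_index S) => //; exact: block_level.
have [S oS Sb] := level_partition b.
have E i k : block_index S i = block_index S k <-> b i = b k.
  have Eb : (block_index S i == block_index S k) = (b i == b k) by rewrite !eq_ltnE !Sb.
  by split=> /eqP; [rewrite Eb|rewrite -Eb] => /eqP.
have cS : cubical S.
  apply/allP => B BS; have BE : B = nth finset.set0 S (index B S) by rewrite nth_index.
  have iS : (index B S < size S)%N by rewrite index_mem.
  rewrite leqNgt; apply/negP => /card_gt2P[i [k [l [[iB kB lB] [ik kl li]]]]].
  move: iB kB lB; rewrite BE !mem_block_index// => /eqP iB /eqP kB /eqP lB.
  have bik : b i = b k by apply/E; rewrite iB.
  have bil : b i = b l by apply/E; rewrite iB.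
  by case: (cb i k l bik bil) => e; move: ik kl li; rewrite e eqxx.
exists S; split=> //; rewrite face_cell//.
by rewrite (cell_eq Sb).
Qed.

End Faces.

(** * Soft ranks *)

Section BoxesCubes.
Variables (R : realType) (n : nat) (lam : 'I_n.+1 -> R) (om : R).
Hypothesis lam_incr : forall i j : 'I_n.+1, (i < j)%N -> lam i < lam j.
Hypothesis om_gt0 : 0 < om.
Hypothesis om_gap : forall i j : 'I_n.+1, (i < j)%N -> om <= lam j - lam i.
Implicit Types (a : 'I_n -> R) (b : 'I_n -> nat) (s : 'S_n) (x z : 'rV[R]_n).

Local Notation lo := (lo lam).
Local Notation hi := (hi lam).
Local Notation in_box := (in_box lam).

(** A ramp from 0 to 1 of width [om], replacing the step function. *)
Definition zeta (t : R) : R := clamp (2^-1 + t / om).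

(** With the step function in place of [zeta] this would be the rank of [a i],
    counted from 1. *)
Definition soft_rank a i : R := 1 + \sum_(k | k != i) zeta (a i - a k).

Lemma zeta_ge0 t : 0 <= zeta t. Proof. exact: clamp_ge0. Qed.
Lemma zeta_le1 t : zeta t <= 1. Proof. exact: clamp_le1. Qed.

Lemma zeta0 t : t <= - (om / 2) -> zeta t = 0.
Proof.
move=> h; apply: clamp0; have : t / om <= - 2^-1; last by lra.
by rewrite ler_pdivrMr// mulNr mulrC.
Qed.

Lemma zeta1 t : om / 2 <= t -> zeta t = 1.
Proof.
move=> h; apply: clamp1; have : 2^-1 <= t / om; last by lra.
by rewrite ler_pdivlMr// mulrC.
Qed.

Lemma zetaN t : zeta t + zeta (- t) = 1.
Proof.
have [h|h] := leP t (- (om / 2)); first by rewrite zeta0// zeta1 ?add0r// lerNr.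
have [h'|h'] := leP (om / 2) t; first by rewrite zeta1// zeta0 ?addr0// lerN2.
have : - 2^-1 < t / om by rewrite ltr_pdivlMr// mulNr mulrC.
have : t / om < 2^-1 by rewrite ltr_pdivrMr// mulrC.
move=> h1 h2; rewrite /zeta mulNr !clampE; lra.
Qed.

Lemma zeta_half t : 0 <= t -> 2^-1 <= zeta t.
Proof.
move=> t0; have <- : zeta 0 = 2^-1 by have := zetaN 0; rewrite oppr0; lra.
apply: le_clamp; rewrite mul0r addr0 lerDl.
by apply: divr_ge0 => //; exact: ltW.
Qed.

(** The ramp only matters within a block: it is 0 or 1 between entries of different
    blocks, and its values at opposite arguments add up to 1. *)
Lemma soft_rank_cell b a : cubical_level b ->
  (forall i k, (b i < b k)%N -> om / 2 <= a k - a i) ->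
  cell R b (\row_i soft_rank a i).
Proof.
move=> cb ba.
have rE i : soft_rank a i = (below b i).+1%:R +
    \sum_(k | (k != i) && (b k == b i)) zeta (a i - a k).
  rewrite /soft_rank (bigID (fun k => b k == b i)) /=.
  rewrite [X in 1 + (_ + X)](_ : _ = (below b i)%:R); first by rewrite -natr1; ring.
  rewrite (bigID (fun k => (b k < b i)%N)) /= [X in _ + X]big1 ?addr0; last first.
    move=> k; rewrite -leqNgt => /andP[/andP[_ ki] ik]; apply: zeta0.
    have /ba : (b i < b k)%N by rewrite ltn_neqAle ik eq_sym ki.
    by rewrite -[X in _ -> X <= _]opprK opprB lerN2.
  rewrite (eq_bigr (fun=> 1)) => [|k /andP[_ /ba]]; last exact: zeta1.
  rewrite sumr_const; congr (_ *+ _); apply: eq_card => k; rewrite !inE.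
  rewrite unfold_in; case: (ltngtP (b k) (b i)) => //; rewrite ?andbF ?andbT//.
  by move=> h; apply: contraTneq h => ->; rewrite ltnn.
have single i : (forall k, b k = b i -> k = i) ->
    \sum_(k | (k != i) && (b k == b i)) zeta (a i - a k) = 0.
  by move=> no; apply: big1 => k /andP[ki /eqP/no e]; rewrite e eqxx in ki.
have double i k : i != k -> b i = b k ->
    \sum_(l | (l != i) && (b l == b i)) zeta (a i - a l) = zeta (a i - a k).
  move=> ik bik; apply: big_pred1 => l /=; apply/andP/eqP => [[li /eqP bl]|->].
    by case: (card_level2 cb ik bik bl) => // e; rewrite e eqxx in li.
  by rewrite eq_sym ik bik.
split=> [i|i no|i k ik bik]; rewrite !mxE.
- rewrite rE -[(below b i).+2]addn1 natrD; have [no|[k ik bik]] := level_cases b i.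
    by rewrite single// addr0 lexx lerDl ler0n.
  rewrite (double _ _ ik bik) lerDl zeta_ge0 /=.
  by rewrite lerD2l zeta_le1.
- by rewrite rE single// addr0.
- have ki : k != i by rewrite eq_sym.
  rewrite !rE (double _ _ ik bik) (double _ _ ki (esym bik)) -(below_eq bik).
  rewrite addrACA -[a k - a i]opprB zetaN -[X in _ + X = _]/(1%:R) -!natrD; congr (_%:R); lia.
Qed.

(** Entries of the boxes at distance less than [om / 2] form disjoint pairs; they get
    the same level, and other entries are separated by the level. *)
Definition early_level a (i : 'I_n) : nat := #|[pred k | a k <= a i - om / 2]|.

Lemma early_level_lt s a i k : in_box s a ->
  (early_level a i < early_level a k)%N = (om / 2 <= a k - a i).
Proof.
move=> sa; have o := om_gt0; apply/idP/idP => [|h].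
  apply: contraTT; rewrite -ltNge -leqNgt => h.
  apply/subset_leq_card/fintype.subsetP => l; rewrite !inE => lk.
  rewrite leNgt; apply/negP => il.
  have il' : l != i by apply/eqP => e; rewrite e in lk il; lra.
  have kl : k != l by apply/eqP => e; rewrite e in lk; lra.
  have [e|ik] := eqVneq i k; first by rewrite e in il; lra.
  rewrite eq_sym in il'.
  case: (box_three om_gt0 om_gap sa ik kl il'); rewrite leNgt ltr_norml => /negP; apply;
    apply/andP; split; lra.
apply: proper_card; apply/properP; split.
  by apply/fintype.subsetP => l; rewrite !inE; lra.
by exists i; rewrite !inE; lra.
Qed.

Lemma soft_rank_cubes s a : in_box s a ->
  cubical_complex R n (\row_i soft_rank a i).
Proof.
move=> sa; suff cb : cubical_level (early_level a).
  apply/cubical_complexP; exists (early_level a) => //.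
  by apply: soft_rank_cell => // i k; rewrite (early_level_lt _ _ sa).
have o := om_gt0.
have near i k : early_level a i = early_level a k -> `|a i - a k| < om / 2.
  move=> e; rewrite ltr_norml; apply/andP; split; last first.
    by rewrite ltNge -(early_level_lt _ _ sa) e ltnn.
  by rewrite ltrNl opprB ltNge -(early_level_lt _ _ sa) e ltnn.
move=> i k l ik il.
have [->|nik] := eqVneq i k; first by constructor 1.
have [->|nkl] := eqVneq k l; first by constructor 2.
have [->|nil] := eqVneq i l; first by constructor 3.
exfalso; have := near _ _ ik; have := near _ _ il; have := near _ _ (etrans (esym ik) il).
case: (box_three om_gt0 om_gap sa nik nkl nil) => h h1 h2 h3; lra.
Qed.

(** Piecewise linear with [p + 1/2] sent to [lo p] and [p + 3/2] to [hi p]. *)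
Definition center_line (z : R) : R :=
  lam ord0 + \sum_(p < n) (hi p - lo p) * clamp (z - p%:R - 2^-1).

Lemma gap_gt0 p : 0 < hi p - lo p.
Proof. by rewrite subr_gt0; exact: lam_incr. Qed.

Lemma center_line_box (p : 'I_n) (z : R) : p%:R + 2^-1 <= z -> z <= p%:R + 1 + 2^-1 ->
  lo p <= center_line z <= hi p.
Proof.
move=> z1 z2.
have tele m (mn : (m <= n)%N) : \sum_(q < n | (q < m)%N) (hi q - lo q) =
    lam (inord m) - lam ord0.
  elim: m mn => [|m IHm] mn.
    rewrite big_pred0//; have -> : inord 0 = ord0 :> 'I_n.+1 by apply: val_inj; rewrite /= inordK.
    by rewrite subrr.
  rewrite (bigD1 (Ordinal mn))//= (eq_bigl (fun q : 'I_n => (q < m)%N)); last first.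
    by move=> q; rewrite -val_eqE /= ltnS; case: ltngtP.
  rewrite IHm 1?ltnW//; have -> : hi (Ordinal mn) = lam (inord m.+1).
    by rewrite /hi; congr lam; apply: val_inj; rewrite /= inordK//.
  have -> : lo (Ordinal mn) = lam (inord m).
    by rewrite /lo; congr lam; apply: val_inj; rewrite /= inordK// ltnS ltnW.
  ring.
have E : center_line z = lo p + (hi p - lo p) * clamp (z - p%:R - 2^-1).
  rewrite /center_line (bigID (fun q : 'I_n => (q < p)%N)) /=.
  rewrite (eq_bigr (fun q => hi q - lo q)) => [|q qp]; last first.
    have : (q%:R : R) + 1 <= p%:R by rewrite natr1 ler_nat.
    by move=> ?; rewrite clamp1 ?mulr1//; lra.
  rewrite (tele _ (ltnW (ltn_ord p))) (bigD1 p) ?ltnn//= big1 => [|q]; last first.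
    rewrite -leqNgt => /andP[pq qp].
    have pq' : (p < q)%N by rewrite ltn_neqAle pq andbT val_eqE eq_sym.
    have : (p%:R : R) + 1 <= q%:R by rewrite natr1 ler_nat.
    by move=> ?; rewrite clamp0 ?mulr0//; lra.
  have -> : lo p = lam (inord p).
    by rewrite /lo; congr lam; apply: val_inj; rewrite /= inordK// ltnS ltnW.
  ring.
rewrite E; have := gap_gt0 p; have := clamp_ge0 (z - p%:R - 2^-1).
have := clamp_le1 (z - p%:R - 2^-1); set c := clamp _ => c1 c0 g.
apply/andP; split; nra.
Qed.

Lemma center_line_far (j : 'I_n) (z z' : R) : z <= j%:R -> j%:R + 1 <= z' ->
  om / 2 <= center_line z' - center_line z.
Proof.
move=> zj jz; rewrite /center_line opprD addrACA subrr add0r -sumrB (bigD1 j)//=.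
rewrite [clamp (z - _ - _)]clamp0 ?mulr0 ?subr0; last by lra.
have h : 2^-1 <= clamp (z' - j%:R - 2^-1).
  have {1}<- : clamp (2^-1 : R) = 2^-1 by apply: clampE; lra.
  by apply: le_clamp; lra.
have g : om <= hi j - lo j by exact: om_gap.
rewrite -[X in X <= _]addr0; apply: lerD; first by have o := om_gt0; nra.
apply: sumr_ge0 => p _; rewrite -mulrBr; apply: mulr_ge0; first exact/ltW/gap_gt0.
by rewrite subr_ge0; apply: le_clamp; lra.
Qed.

(** Sort by level, and within a level by the entries of [z]: of two partners, the
    smaller is at most N + 3/2 and the other at least N + 3/2. *)
Lemma cell_box b z : cubical_level b -> cell R b z ->
  exists s, in_box s (fun i => center_line (z ord0 i)).
Proof.
move=> cb [z1 z2 z3].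
pose lt i k := (b i < b k)%N || ((b i == b k) && ((z ord0 i < z ord0 k) ||
   ((z ord0 i == z ord0 k) && (i < k)%N))).
have [s sP] : exists s : 'S_n, forall i k, (s i < s k)%N = lt i k.
  apply: rank_perm; rewrite /lt.
  - by move=> i; rewrite !ltnn ltxx !andbF.
  - move=> k i m; case: (ltngtP (b i) (b k)) => [ik _|//|-> /=].
      by case/orP => [/(ltn_trans ik)->//|/andP[/eqP<- _]]; rewrite ik.
    move=> ik /orP[->//|/andP[-> /=]] km; rewrite orbC; apply/orP; left.
    case/orP: ik => [ik|/andP[/eqP-> ik]]; case/orP: km => [km|/andP[/eqP<- km]].
    + by rewrite (lt_trans ik km).
    + by rewrite ik.
    + by rewrite km.
    + by rewrite eqxx (ltn_trans ik km) orbT.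
  - move=> i k ik; case: (ltngtP (b i) (b k)) => //= _; case: ltgtP => //= _.
    by move: ik; rewrite neq_ltn => /orP[] ->; rewrite ?orbT.
have sE i : (s i : nat) = (below b i + #|[pred k | (b k == b i) && lt k i]|)%N.
  rewrite -[LHS](card_perm_lt s (ltnW (ltn_ord (s i)))).
  rewrite -(cardID [pred k | (b k < b i)%N]); congr (_ + _)%N; apply: eq_card => k.
    by rewrite !inE sP /lt; case: (b k < b i)%N; rewrite ?andbF.
  by rewrite !inE sP /lt; case: ltngtP => //= ?; rewrite ?andbF ?andbT.
exists s => i; have := z1 i; rewrite -[(below b i).+2]addn1 natrD -natr1 => /andP[zi1 zi2].
have [no|[k ik bik]] := level_cases b i.
  have si : s i = below b i :> nat.
    rewrite sE eq_card0 ?addn0// => k; rewrite !inE; apply/negbTE/negP => /andP[/eqP/no->].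
    by rewrite -sP ltnn.
  have := z2 i no; rewrite -natr1 => zE.
  by apply: center_line_box; rewrite si; lra.
have := z3 i k ik bik; rewrite natrD natrD => zik.
have [ltki|nltki] := boolP (lt k i).
  have si : s i = (below b i).+1 :> nat.
    rewrite sE (fintype.eq_card1 (x := k)) ?addn1// => l; rewrite !inE.
    apply/andP/eqP => [[/eqP bl li]|->]; last by rewrite bik eqxx.
    by case: (card_level2 cb ik bik bl) => // e; move: li; rewrite e -sP ltnn.
  have zki : z ord0 k <= z ord0 i.
    move: ltki; rewrite /lt bik ltnn eqxx /= => /orP[/ltW//|/andP[/eqP->//]].
  by apply: center_line_box; rewrite si -natr1; lra.
have ltik : lt i k.
  have : s i != s k by rewrite (inj_eq perm_inj).
  by rewrite neq_ltn !sP (negPf nltki) orbF.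
have si : s i = below b i :> nat.
  rewrite sE eq_card0 ?addn0// => l; rewrite !inE; apply/negbTE/negP => /andP[/eqP bl].
  case: (card_level2 cb ik bik bl) => ->; first by rewrite -sP ltnn.
  by rewrite (negPf nltki).
have zki : z ord0 i <= z ord0 k.
  by move: ltik; rewrite /lt bik ltnn eqxx /= => /orP[/ltW//|/andP[/eqP->//]].
by apply: center_line_box; rewrite si; lra.
Qed.

(** Levels do not change: entries of different levels are on two sides of a unit
    interval [N, N + 1], which [center_line] maps to length at least [om / 2]. *)
Lemma cell_soft_rank b z : cubical_level b -> cell R b z ->
  cell R b (\row_i soft_rank (fun i => center_line (z ord0 i)) i).
Proof.
move=> cb cz; apply: soft_rank_cell => // i k bik; case: cz => [z1 z2 z3].
have Nn : (below b k < n)%N by apply: leq_trans (below_upto b k) (upto_le b k).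
apply: (@center_line_far (Ordinal Nn)) => /=; last first.
  by have /andP[] := z1 k; rewrite natr1.
apply: (@le_trans _ _ (upto b i)%:R); last by rewrite ler_nat; exact: upto_below.
have [no|[l il bil]] := level_cases b i; first by rewrite z2// ler_nat below_upto.
by have /andP[_ /le_trans->//] := z1 i; rewrite ler_nat -addn2; exact: below_upto2 il bil.
Qed.

(** The soft rank differs from the position counted from 1 by at most 1/2, because
    at most one other entry is close and its ramp has the sign of the order. *)
Lemma soft_rank_box s a : in_box s a ->
  in_box s (fun i => center_line (soft_rank a i)).
Proof.
move=> sa i; have o := om_gt0.
have lt0 k : (s k < s i)%N -> a k <= a i by exact: (box_le lam_incr sa).
have gt0 k : (s i < s k)%N -> a i <= a k by exact: (box_le lam_incr sa).
(* The contribution of [k] to soft rank minus position. *)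
pose d k := zeta (a i - a k) - (s k < s i)%N%:R.
have d_small k : k != i -> `|d k| <= 2^-1.
  move=> ki; rewrite ler_norml /d; have := zeta_le1 (a i - a k).
  have := zeta_ge0 (a i - a k); have /orP : (s k < s i)%N || (s i < s k)%N.
    by rewrite -neq_ltn val_eqE (inj_eq perm_inj).
  case=> h.
    have : 2^-1 <= zeta (a i - a k) by apply: zeta_half; rewrite subr_ge0 lt0.
    by rewrite h mulr1n => ? ? ?; apply/andP; split; lra.
  have : 2^-1 <= zeta (- (a i - a k)) by apply: zeta_half; rewrite oppr_ge0 subr_le0 gt0.
  have := zetaN (a i - a k); rewrite ltnNge ltnW//= mulr0n => ? ? ? ?.
  by apply/andP; split; lra.
have d_far k : k != i -> om / 2 <= `|a i - a k| -> d k = 0.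
  move=> ki; have /orP : (s k < s i)%N || (s i < s k)%N.
    by rewrite -neq_ltn val_eqE (inj_eq perm_inj).
  case=> h; rewrite /d.
    by rewrite ger0_norm ?subr_ge0 ?lt0// => /zeta1->; rewrite h mulr1n subrr.
  rewrite ler0_norm ?subr_le0 ?gt0// lerNr => /zeta0->.
  by rewrite ltnNge ltnW//= subr0.
have rE : soft_rank a i = (s i)%:R + 1 + \sum_(k | k != i) d k.
  rewrite /d sumrB /soft_rank -natr_sum.
  have -> : (\sum_(k | k != i) (s k < s i)%N)%N = s i.
    rewrite -[RHS](card_perm_lt s (ltnW (ltn_ord (s i)))) -sum1_card big_mkcond.
    rewrite [RHS]big_mkcond; apply: eq_bigr => k _; rewrite inE.
    by case: eqVneq => [->|_]; rewrite ?ltnn//; case: ltnP.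
  ring.
have : `|\sum_(k | k != i) d k| <= 2^-1.
  have [[k ki near]|no] := pselect (exists2 k, k != i & `|a i - a k| < om / 2).
    rewrite (bigD1 k)//= big1 ?addr0 ?d_small// => l /andP[li lk].
    apply: d_far => //; rewrite leNgt; apply/negP => near'.
    rewrite eq_sym in ki; rewrite eq_sym in lk; rewrite eq_sym in li.
    move: near near'; rewrite !ltr_norml => /andP[? ?] /andP[? ?].
    by case: (box_three om_gt0 om_gap sa ki lk li); rewrite leNgt ltr_norml => /negP;
      apply; apply/andP; split; lra.
  rewrite big1 ?normr0 ?invr_ge0// => k ki; apply: d_far => //.
  by rewrite leNgt; apply/negP => near; apply: no; exists k.
rewrite ler_norml => /andP[h1 h2].
by apply: center_line_box; rewrite rE; lra.
Qed.

End BoxesCubes.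

(** * Boxes and cubical faces *)

Section BoxesCubesHomotopy.
Variables (R : realType) (n : nat) (lam : 'I_n.+1 -> R) (om : R).
Hypothesis lam_incr : forall i j : 'I_n.+1, (i < j)%N -> lam i < lam j.
Hypothesis om_gt0 : 0 < om.
Hypothesis om_gap : forall i j : 'I_n.+1, (i < j)%N -> om <= lam j - lam i.
Local Notation boxes := (interval_boxes lam).
Local Notation cubes := (cubical_complex R n).

Lemma soft_rank_mem (x : boxes) : cubical_complex R n (\row_i soft_rank om ((set_val x) ord0) i).
Proof.
have /interval_boxesP[s sx] := set_valP x.
exact: (soft_rank_cubes om_gt0 om_gap sx).
Qed.

Lemma center_line_mem (z : cubes) :
  interval_boxes lam (\row_i center_line lam ((set_val z) ord0 i)).
Proof.
have /cubical_complexP[b cb cz] := set_valP z.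
have [s sz] := cell_box lam_incr cb cz.
by apply/interval_boxesP; exists s; rewrite row_ord0.
Qed.

Definition boxes_to_cubes (x : boxes) : cubes := to_sub (soft_rank_mem x).
Definition cubes_to_boxes (z : cubes) : boxes := to_sub (center_line_mem z).

Lemma boxes_to_cubes_continuous : continuous boxes_to_cubes.
Proof.
apply: continuous_to_sub; apply: continuous_mx => i j /=.
under eq_fun do rewrite mxE.
apply: cont_add; first exact: cont_cst.
apply: cont_sum => k _; apply: (cont_comp (@clamp_continuous R)).
apply: cont_add; first exact: cont_cst.
apply: cont_mul; last exact: cont_cst.
by apply: cont_sub; apply: cont_coord; exact: val_continuous.
Qed.

Lemma cubes_to_boxes_continuous : continuous cubes_to_boxes.
Proof.
apply: continuous_to_sub; apply: continuous_mx => i j /=.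
under eq_fun do rewrite mxE.
apply: cont_add; first exact: cont_cst.
apply: cont_sum => k _; apply: cont_mul; first exact: cont_cst.
apply: (cont_comp (@clamp_continuous R)).
apply: cont_sub; last exact: cont_cst.
apply: cont_sub; last exact: cont_cst.
by apply: cont_coord; exact: val_continuous.
Qed.

Lemma cubes_boxes_cubes : homotopic_total R (boxes_to_cubes \o cubes_to_boxes) id.
Proof.
apply: segment_homotopic => [||z t t0 t1].
- exact: cont_comp boxes_to_cubes_continuous cubes_to_boxes_continuous.
- exact: cont_id.
have /cubical_complexP[b cb cz] := set_valP z.
apply/cubical_complexP; exists b => //; apply: cell_convex => //.
have -> : set_val ((boxes_to_cubes \o cubes_to_boxes) z) =
    \row_i soft_rank om (fun k => center_line lam (set_val z ord0 k)) i.
  apply/rowP => i; rewrite /= !mxE; congr (soft_rank om _ i); exact: row_ord0.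
exact: (cell_soft_rank lam_incr om_gt0 om_gap cb cz).
Qed.

Lemma boxes_cubes_boxes : homotopic_total R (cubes_to_boxes \o boxes_to_cubes) id.
Proof.
apply: segment_homotopic => [||x t t0 t1].
- exact: cont_comp cubes_to_boxes_continuous boxes_to_cubes_continuous.
- exact: cont_id.
have /interval_boxesP[s sx] := set_valP x.
apply/interval_boxesP; exists s.
have := in_box_convex (soft_rank_box lam_incr om_gt0 om_gap sx) sx t0 t1.
by congr in_box; apply/funext => i; rewrite !mxE.
Qed.

End BoxesCubesHomotopy.

(** * Spectra of complex arrow matrices *)

Section ArrowCharPoly.
Variables (F : fieldType) (n : nat).

Lemma arrow_poly_ext (t u : F) (a a' c c' : 'I_n -> F) :
  t = u -> a =1 a' -> c =1 c' -> arrow_poly t a c = arrow_poly u a' c'.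
Proof. by move=> -> /funext -> /funext ->. Qed.

(** With q the product of the diagonal entries of the lower right block D of
    X - A, multiply X - A by the block matrix with columns (q, v) and (0, 1), where
    v = - q D^-1 times the lower left block.  The product is block triangular,
    and q cancels in the determinant. *)
Lemma char_poly_arrow (A : 'M[F]_n.+1) :
  (forall i j, i != j -> i != ord0 -> j != ord0 -> A i j = 0) ->
  char_poly A = arrow_poly (A ord0 ord0) (fun i => A (lift ord0 i) (lift ord0 i))
    (fun i => A ord0 (lift ord0 i) * A (lift ord0 i) ord0).
Proof.
move=> arrow; set a := fun i => A (lift ord0 i) (lift ord0 i).
pose M : 'M[{poly F}]_(1 + n) := char_poly_mx A.
have ME i j : M i j = ('X *+ (i == j) - (A i j)%:P) by rewrite !mxE.
have l0 (i : 'I_1) : lshift n i = ord0 :> 'I_(1 + n) by apply: val_inj; rewrite (ord1 i).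
have r1 (i : 'I_n) : rshift 1 i = lift ord0 i :> 'I_(1 + n) by apply: val_inj.
have lift_neq0 (i : 'I_n) : (lift ord0 i == ord0 :> 'I_n.+1) = false by [].
pose q := diag_poly a.
pose d : 'rV[{poly F}]_n := \row_i ('X - (a i)%:P).
pose v : 'cV[{poly F}]_n := \col_i ((A (lift ord0 i) ord0)%:P * codiag_poly a i).
have DE : drsubmx M = diag_mx d.
  apply/matrixP => i j; rewrite !mxE !r1 (inj_eq (@lift_inj _ ord0)).
  case: eqVneq => [->|ij]; first by rewrite mulr1n.
  by rewrite mulr0n add0r arrow ?lift_neq0 ?(inj_eq (@lift_inj _ ord0))// oppr0.
have det_d : \det (diag_mx d) = q.
  by rewrite det_diag; apply: eq_bigr => i _; rewrite mxE.
have q0 : q != 0 by apply/monic_neq0/monic_prod_XsubC.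
pose P : 'M[{poly F}]_(1 + n) := block_mx q%:M 0 v 1%:M.
have detP : \det P = q by rewrite det_lblock det_scalar1 det1 mulr1.
have PE : M *m P = block_mx (ulsubmx M *m q%:M + ursubmx M *m v) (ursubmx M) 0 (diag_mx d).
  rewrite -{1}[M]submxK mulmx_block !mulmx0 !mulmx1 !add0r DE; congr block_mx.
  apply/matrixP => i j; rewrite !mxE big_ord1 !mxE [j]ord1 eqxx mulr1n !l0 !r1 lift_neq0.
  rewrite (bigD1 i)//= big1 ?addr0 => [|k ki]; last first.
    by rewrite !mxE eq_sym (negPf ki) mulr0n mul0r.
  rewrite !mxE eqxx mulr1n mulr0n add0r /q (diag_polyE a i); ring.
have detMP : \det M * \det P = \det (ulsubmx M *m q%:M + ursubmx M *m v) * q.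
  by rewrite -det_mulmx PE det_ublock det_d.
apply: (mulIf q0); rewrite -{1}detP [LHS]detMP; congr (_ * _).
rewrite [X in \det X]mx11_scalar det_scalar1 !mxE big_ord1 !mxE eqxx mulr1n !l0 eqxx mulr1n.
rewrite /arrow_poly -/q; congr (_ + _); rewrite -sumrN; apply: eq_bigr => i _.
rewrite !mxE l0 r1 eq_sym lift_neq0 mulr0n add0r polyCM; ring.
Qed.

Lemma char_poly_spectrum (A : 'M[F]_n.+1) (l : 'I_n.+1 -> F) : injective l ->
  char_poly A = spectral_poly l <-> [set z | eigenvalue A z] = [set l i | i in [set: 'I_n.+1]].
Proof.
move=> l_inj; pose rs := [seq l i | i <- index_enum 'I_n.+1].
have rsE : spectral_poly l = \prod_(z <- rs) ('X - z%:P) by rewrite big_map.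
split=> [E|E].
  apply/seteqP; split=> z /=; rewrite eigenvalue_root_char E rsE root_prod_XsubC.
    by case/mapP => i _ ->; exists i.
  by case=> i _ <-; apply: map_f; rewrite mem_index_enum.
have := @all_roots_prod_XsubC _ (char_poly A) rs.
rewrite size_char_poly (monicP (char_poly_monic A)) scale1r -rsE; apply.
- by rewrite size_map /index_enum -enumT size_enum_ord.
- apply/allP => _ /mapP[i _ ->]; rewrite -eigenvalue_root_char.
  by have : [set z | eigenvalue A z] (l i) by rewrite E; exists i.
- by rewrite uniq_rootsE map_inj_uniq ?index_enum_uniq.
Qed.

End ArrowCharPoly.

Section RealComplex.
Variable R : realType.
Local Notation C := R[i].
Local Notation rc := (real_complex R).

Lemma map_arrow_poly n (t : R) (a c : 'I_n -> R) :
  map_poly rc (arrow_poly t a c) = arrow_poly (t%:C) (fun i => (a i)%:C) (fun i => (c i)%:C).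
Proof.
rewrite /arrow_poly /diag_poly rmorphB rmorphM /= map_polyXsubC map_prod_XsubC rmorph_sum.
congr (_ - _); apply: eq_bigr => i _.
by rewrite rmorphM /= map_polyC map_prod_XsubC.
Qed.

Lemma map_spectral_poly n (lam : 'I_n.+1 -> R) :
  map_poly rc (spectral_poly lam) = spectral_poly (fun j => (lam j)%:C).
Proof. exact: map_prod_XsubC. Qed.

Lemma Re_continuous : continuous (@complex.Re R : C -> R).
Proof.
move=> z U [e /= e0 eU].
have e0' : 0 < e%:C :> C by rewrite ltcR.
exists e%:C => //= w zw; apply: eU; rewrite /ball_ /= -ltcR; apply: le_lt_trans zw.
have -> : complex.Re z - complex.Re w = complex.Re (z - w) by case: z w => ? ? [].
exact: normc_ge_Re.
Qed.

Lemma Im_continuous : continuous (@complex.Im R : C -> R).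
Proof.
move=> z U [e /= e0 eU].
have e0' : 0 < e%:C :> C by rewrite ltcR.
exists e%:C => //= w zw; apply: eU; rewrite /ball_ /= -ltcR; apply: le_lt_trans zw.
have -> : complex.Im z - complex.Im w = complex.Im (z - w) by case: z w => ? ? [].
rewrite normc_def lecR -sqrtr_sqr; apply: ler_wsqrtr.
by rewrite lerDr sqr_ge0.
Qed.

Lemma real_complex_continuous : continuous (fun x : R => x%:C : C).
Proof.
move=> x U [e /= e0 eU].
have eE : e = (complex.Re e)%:C by rewrite RRe_real// gtr0_real.
have e0' : 0 < complex.Re e by rewrite -ltcR -eE.
exists (complex.Re e) => //= y xy; apply: eU.
rewrite /ball_ /= -rmorphB /= normc_def /= expr0n addr0.
by rewrite sqrtr_sqr eE ltcR.
Qed.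

End RealComplex.

(** * Orbits of arrow matrices *)

Section OrbitModel.
Variables (R : realType) (n : nat) (lam : 'I_n.+1 -> R).
Hypothesis lam_incr : forall i j : 'I_n.+1, (i < j)%N -> lam i < lam j.
Local Notation C := R[i].
Local Notation E := ('rV[R]_n * 'rV[R]_n)%type.
Local Notation up := (lift ord0).
Implicit Types A B D : 'M[C]_n.+1.

Definition diagv A : 'rV[R]_n := \row_i complex.Re (A (up i) (up i)).
Definition weightv A : 'rV[R]_n :=
  \row_i (complex.Re (A ord0 (up i)) ^+ 2 + complex.Im (A ord0 (up i)) ^+ 2).

Lemma herm_entry A i j : A \is hermsymmx -> A i j = (A j i)^*%R.
Proof.
move=> /is_hermitianmxP; rewrite expr0 scale1r => {1}->.
by rewrite !mxE.
Qed.

Lemma herm_diag A i : A \is hermsymmx -> A i i = (complex.Re (A i i))%:C.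
Proof.
by move=> /(herm_entry i i) h; rewrite RRe_real//; apply/CrealP; exact/esym.
Qed.

Lemma weightvE A i : ((weightv A) ord0 i)%:C = `|A ord0 (up i)| ^+ 2.
Proof. by rewrite mxE add_Re2_Im2. Qed.

Lemma lamC_inj : injective (fun j => (lam j)%:C).
Proof. by move=> i j /(congr1 (@complex.Re R)) /=; exact: lam_inj. Qed.

Lemma arrow_space_poly A : arrow_space lam A ->
  arrow_poly (complex.Re (A ord0 ord0)) (diagv A ord0) (weightv A ord0) =
  spectral_poly lam.
Proof.
move=> [herm arrow /(char_poly_spectrum _ lamC_inj) spec].
apply: (map_poly_inj (real_complex R)); rewrite map_arrow_poly map_spectral_poly -spec.
rewrite (char_poly_arrow arrow); apply: arrow_poly_ext => [|i|i].
- exact/esym/herm_diag.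
- by rewrite mxE; exact/esym/herm_diag.
- by rewrite weightvE normCK (herm_entry (up i) ord0 herm).
Qed.

Lemma arrow_space_model A : arrow_space lam A -> model_space lam (diagv A, weightv A).
Proof.
move=> /arrow_space_poly E; split=> /=; last by rewrite -(corner_unique E).
by move=> i; rewrite mxE addr_ge0// sqr_ge0.
Qed.

(** [None] stands for the index 0. *)
Definition arrow_entry (p : E) (u v : option 'I_n) : R :=
  match u, v with
  | None, None => corner lam (p.1 ord0)
  | None, Some k | Some k, None => Num.sqrt (p.2 ord0 k)
  | Some k, Some l => if k == l then p.1 ord0 k else 0
  end.

Definition arrow_of (p : E) : 'M[C]_n.+1 :=
  \matrix_(i, j) (arrow_entry p (unlift ord0 i) (unlift ord0 j))%:C.

Lemma arrow_of00 p : arrow_of p ord0 ord0 = (corner lam (p.1 ord0))%:C.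
Proof. by rewrite mxE unlift_none. Qed.

Lemma arrow_of0u p k : arrow_of p ord0 (up k) = (Num.sqrt (p.2 ord0 k))%:C.
Proof. by rewrite mxE unlift_none liftK. Qed.

Lemma arrow_ofu0 p k : arrow_of p (up k) ord0 = (Num.sqrt (p.2 ord0 k))%:C.
Proof. by rewrite mxE unlift_none liftK. Qed.

Lemma arrow_ofuu p k l : arrow_of p (up k) (up l) = (if k == l then p.1 ord0 k else 0)%:C.
Proof. by rewrite mxE !liftK. Qed.

Lemma arrow_entryC p u v : arrow_entry p u v = arrow_entry p v u.
Proof. by case: u v => [k|] [l|] //=; rewrite eq_sym; case: eqP => // ->. Qed.

Lemma up_cases (i : 'I_n.+1) : i = ord0 \/ exists k, i = up k.
Proof. by case: (unliftP ord0 i) => [k ->|->]; [right; exists k|left]. Qed.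

Lemma arrow_of_arrow p : is_arrow (arrow_of p).
Proof.
move=> i j; case: (up_cases i) => [->|[k ->]]; first by rewrite eqxx.
case: (up_cases j) => [->|[l ->]]; first by rewrite eqxx.
by rewrite (inj_eq (@lift_inj _ ord0)) arrow_ofuu => /negPf ->.
Qed.

Lemma arrow_of_space p : model_space lam p -> arrow_space lam (arrow_of p).
Proof.
move=> [c_ge0 mE]; split.
- apply/is_hermitianmxP; rewrite expr0 scale1r; apply/matrixP => i j.
  by rewrite !mxE arrow_entryC; exact/esym/conjc_real.
- exact: arrow_of_arrow.
apply/(char_poly_spectrum _ lamC_inj).
rewrite (char_poly_arrow (arrow_of_arrow p)).
rewrite -map_spectral_poly -mE map_arrow_poly; apply: arrow_poly_ext => [|i|i].
- exact: arrow_of00.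
- by rewrite arrow_ofuu eqxx.
- by rewrite arrow_of0u arrow_ofu0 -rmorphM /= -expr2 sqr_sqrtr.
Qed.

Lemma model_arrow_of p : model_space lam p -> (diagv (arrow_of p), weightv (arrow_of p)) = p.
Proof.
case: p => a c [/= c_ge0 _]; congr pair; apply/rowP => i; rewrite mxE.
  by rewrite arrow_ofuu eqxx.
by rewrite arrow_of0u /= expr0n addr0 sqr_sqrtr.
Qed.

Lemma torus_act_entry (d : 'rV[C]_n.+1) A i j :
  torus_act (diag_mx d) A i j = d ord0 i * A i j * (d ord0 j)^*%R.
Proof.
rewrite /torus_act; have -> : ((diag_mx d) ^t* )%sesqui = diag_mx (map_mx Num.conj d).
  by rewrite tr_diag_mx map_diag_mx.
by rewrite mul_diag_mx mul_mx_diag !mxE.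
Qed.

Lemma torusP D : torus D <-> exists2 d : 'rV[C]_n.+1, D = diag_mx d &
  forall i, d ord0 i * (d ord0 i)^*%R = 1.
Proof.
split.
  move=> [/diag_mxP[d ->] /unitarymxP U]; exists d => // i.
  have := congr1 (fun M : 'M[C]_n.+1 => M i i) U.
  rewrite tr_diag_mx map_diag_mx mul_diag_mx !mxE eqxx.
  by rewrite mulr1n.
move=> [d -> dd]; split; first exact: diag_mx_is_diag.
apply/unitarymxP; rewrite tr_diag_mx map_diag_mx mul_diag_mx; apply/matrixP => i j.
by rewrite !mxE; case: eqVneq => [->|_]; rewrite ?mulr1n ?mulr0n ?mulr0// dd.
Qed.

Lemma same_orbit_invariants A B : same_orbit A B -> diagv A = diagv B /\ weightv A = weightv B.
Proof.
move=> [_ /torusP[d -> dd] ->]; split; apply/rowP => i.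
  by rewrite [LHS]mxE [RHS]mxE torus_act_entry mulrAC dd mul1r.
suff : ((weightv A) ord0 i)%:C = ((weightv (torus_act (diag_mx d) A)) ord0 i)%:C.
  by move=> /(congr1 (@complex.Re R)).
rewrite !weightvE torus_act_entry !normrM norm_conjC.
have dn j : `|d ord0 j| = 1.
  by apply/eqP; rewrite -sqrp_eq1// normCK dd.
by rewrite !dn mul1r mulr1.
Qed.

(** The phases of the entries of row 0 are the diagonal of the torus element, with
    phase 1 for a zero entry. *)
Lemma same_orbit_arrow_of A : arrow_space lam A ->
  same_orbit A (arrow_of (diagv A, weightv A)).
Proof.
move=> sA; have [herm arrow _] := sA.
have mod := arrow_space_model sA.
(* The phase of a complex number. *)
pose ph (z : C) := if z == 0 then 1 else z / `|z|.
have phE z : ph z * (ph z)^*%R = 1.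
  rewrite /ph; case: eqVneq => [_|z0]; first by rewrite conjC1 mulr1.
  by rewrite -normCK normrM normfV normr_id mulfV ?expr1n ?normr_eq0.
have phz z : z * (ph z)^*%R = `|z|.
  rewrite /ph; case: eqVneq => [->|z0]; first by rewrite mul0r normr0.
  have -> : Num.conj (z / `|z|) = Num.conj z / `|z|.
    by rewrite rmorphM fmorphV; congr (_ * _^-1); exact: conj_normC.
  rewrite mulrA -normCK expr2 mulfK ?normr_eq0//.
have php z : ph z * z^*%R = `|z|.
  rewrite -(conj_normC z) -phz [RHS]rmorphM mulrC; congr (_ * _).
  exact/esym/conjCK.
have sqrtE i : (Num.sqrt (weightv A ord0 i))%:C = `|A ord0 (up i)|.
  rewrite normc_def mxE //.
pose d : 'rV[C]_n.+1 := \row_i if unlift ord0 i is Some k then ph (A ord0 (up k)) else 1.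
have d0 : d ord0 ord0 = 1 by rewrite mxE unlift_none.
have du k : d ord0 (up k) = ph (A ord0 (up k)) by rewrite mxE liftK.
exists (diag_mx d).
  apply/torusP; exists d => // i; case: (up_cases i) => [->|[k ->]].
    by rewrite d0 conjC1 mulr1.
  by rewrite du phE.
apply/matrixP => i j; rewrite torus_act_entry.
case: (up_cases i) => [->|[k ->]]; case: (up_cases j) => [->|[l ->]].
- rewrite d0 conjC1 mulr1 mul1r arrow_of00 /= (herm_diag _ herm); congr (_%:C).
  by apply/esym; apply: corner_unique (arrow_space_poly sA).
- by rewrite d0 mul1r du phz arrow_of0u sqrtE.
- by rewrite d0 conjC1 mulr1 du (herm_entry (up k) ord0 herm) arrow_ofu0 sqrtE php.
rewrite arrow_ofuu !du; case: eqVneq => [<-|kl].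
  by rewrite mulrAC phE mul1r /= mxE -herm_diag.
by rewrite (arrow (up k) (up l)) ?(inj_eq (@lift_inj _ ord0))// mulr0 mul0r.
Qed.

End OrbitModel.

(** * The orbit space and the theorem *)

Section OrbitHomeo.
Variables (R : realType) (n : nat) (lam : 'I_n.+1 -> R).
Hypothesis lam_incr : forall i j : 'I_n.+1, (i < j)%N -> lam i < lam j.
Local Notation C := R[i].
Local Notation E := ('rV[R]_n * 'rV[R]_n)%type.
Local Notation model := (model_space lam).
Local Notation boxes := (interval_boxes lam).

Lemma cont_entry (X : topologicalType) (f : X -> 'M[C]_n.+1) i j :
  continuous f -> continuous (fun x => f x i j).
Proof.
move=> cf x; apply: (@continuous_comp X _ _ f (fun M => M i j) x); first exact: cf.
exact: coord_continuous.
Qed.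

Definition orbit_model (x : orbit_space lam) : model :=
  to_sub (arrow_space_model lam_incr (set_valP (repr x))).

Definition model_orbit (p : model) : orbit_space lam :=
  orbit_of (to_sub (arrow_of_space lam_incr (set_valP p))).

Lemma orbit_ofP (A B : arrow_space lam) :
  orbit_of A = orbit_of B <-> same_orbit (\val A) (\val B).
Proof.
split=> [/eqmodP/asboolP//|h].
by apply/eqmodP/asboolP.
Qed.

Lemma orbit_modelE (A : arrow_space lam) :
  set_val (orbit_model (orbit_of A)) = (diagv (\val A), weightv (\val A)).
Proof.
have /orbit_ofP/same_orbit_invariants[d w] : orbit_of (repr (orbit_of A)) = orbit_of A.
  exact: reprK.
by rewrite /= -d -w.
Qed.

Lemma orbit_model_continuous : continuous orbit_model.
Proof.
apply/quotient_continuous; apply: continuous_to_sub.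
have -> : set_val \o (orbit_model \o \pi_(orbit_space lam)%qT) =
    fun A : arrow_space lam => (diagv (\val A), weightv (\val A)).
  by apply/funext => A; exact: orbit_modelE.
have cv : continuous (fun A : arrow_space lam => set_val A) by exact: val_continuous.
have cRe i j : continuous (fun A : arrow_space lam => complex.Re (set_val A i j)).
  exact: (cont_comp (@Re_continuous R) (cont_entry cv)).
have cIm i j : continuous (fun A : arrow_space lam => complex.Im (set_val A i j)).
  exact: (cont_comp (@Im_continuous R) (cont_entry cv)).
apply: cont_pair; apply: continuous_mx => i j; under eq_fun do rewrite mxE ?expr2.
  exact: cRe.
by apply: cont_add; apply: cont_mul; (exact: cRe || exact: cIm).
Qed.

Lemma model_orbit_continuous : continuous model_orbit.
Proof.
apply: (@cont_comp _ _ _ _ (@orbit_of R n lam)); first exact: pi_continuous.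
apply: continuous_to_sub; apply: continuous_mx => i j /=.
under eq_fun do rewrite mxE.
apply: (cont_comp (@real_complex_continuous R)).
have cv : continuous (fun p : model => set_val p) by exact: val_continuous.
rewrite /arrow_entry; case: (unlift ord0 i) => [k|]; case: (unlift ord0 j) => [l|].
- by case: eqP => _; [exact: cont_coord1|exact: cont_cst].
- by apply: (cont_comp (@realfun.sqrt_continuous R)); exact: cont_coord2.
- by apply: (cont_comp (@realfun.sqrt_continuous R)); exact: cont_coord2.
- apply: cont_sub; first exact: cont_cst.
  by apply: cont_sum => k _; exact: cont_coord1.
Qed.

Lemma model_orbitK : cancel model_orbit orbit_model.
Proof.
move=> p; apply: val_inj; rewrite /model_orbit.
transitivity (set_val p); last by [].
transitivity (diagv (arrow_of lam (set_val p)), weightv (arrow_of lam (set_val p))).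
  exact: orbit_modelE.
exact: (model_arrow_of (set_valP p)).
Qed.

Lemma orbit_modelK : cancel orbit_model model_orbit.
Proof.
move=> x; rewrite -[RHS](reprK x); apply/orbit_ofP/same_orbit_sym.
exact: (same_orbit_arrow_of lam_incr (set_valP (repr x))).
Qed.

End OrbitHomeo.

Theorem proposition4p10 (R : realType) (n : nat) (lam : 'I_n.+1 -> R)
    (n_ge1 : (1 <= n)%N)
    (lam_incr : forall i j : 'I_n.+1, (i < j)%N -> lam i < lam j) :
  (exists2 h : orbit_space lam -> interval_boxes lam,
      forall (A : arrow_space lam) (i : 'I_n),
        ((\val (h (orbit_of A))) ord0 i)%:C = (\val A) (lift ord0 i) (lift ord0 i) &
      is_homotopy_equivalence R h) /\
  homotopy_equivalent R (orbit_space lam) (cubical_complex R n).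
Proof.
have [om om_gt0 om_gap] := exists_gap lam_incr.
pose al := orbit_model lam_incr; pose be := model_orbit lam_incr.
pose dg := model_diag lam_incr; pose lf := model_lift lam_incr om_gt0 om_gap.
pose rc := boxes_to_cubes om_gt0 om_gap; pose cr := cubes_to_boxes lam_incr.
have c_al : continuous al by exact: orbit_model_continuous.
have c_be : continuous be by exact: model_orbit_continuous.
have c_dg : continuous dg by exact: model_diag_continuous.
have c_lf : continuous lf by exact: model_lift_continuous.
have c_rc : continuous rc by exact: boxes_to_cubes_continuous.
have c_cr : continuous cr by exact: cubes_to_boxes_continuous.
have al_be : al \o be = id by apply/funext => p; exact: model_orbitK.
have be_al : be \o al = id by apply/funext => x; exact: orbit_modelK.
have c_h : continuous (dg \o al) by exact: cont_comp.
have c_g : continuous (be \o lf) by exact: cont_comp.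
have gh : homotopic_total R ((be \o lf) \o (dg \o al)) id.
  rewrite -[X in homotopic_total _ _ X]be_al.
  apply: (@homotopic_total_comp R _ _ _ _ (lf \o dg) id be al c_be c_al).
  exact: model_lift_diag.
have hg : homotopic_total R ((dg \o al) \o (be \o lf)) id.
  have -> : (dg \o al) \o (be \o lf) = dg \o lf.
    by rewrite -compA (compA al) al_be.
  exact: model_diag_lift.
split.
  exists (dg \o al).
    move=> A i; have [herm _ _] := set_valP A.
    have -> : \val ((dg \o al) (orbit_of A)) = diagv (\val A).
      exact: (congr1 fst (orbit_modelE lam_incr A)).
    by rewrite mxE -herm_diag.
  split=> //; exists (be \o lf); split=> //; exact: homotopic_totalW.
exists (rc \o (dg \o al)); split; first exact: cont_comp.
exists ((be \o lf) \o cr); split; first exact: cont_comp.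
  apply: homotopic_totalW; apply: homotopic_total_trans gh.
  apply: (@homotopic_total_comp _ _ _ _ _ (cr \o rc) id _ _ c_g c_h).
  exact: boxes_cubes_boxes.
apply: homotopic_totalW; apply: (@homotopic_total_trans _ _ _ _ (rc \o cr)).
  apply: (@homotopic_total_comp _ _ _ _ _ ((dg \o al) \o (be \o lf)) id _ _ c_rc c_cr).
  exact: hg.
exact: cubes_boxes_cubes.
Qed.
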